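(* Fix $a>0$. As $b\to+\infty$ through real values, uniformly for $\zeta$ in compact subsets of the complex plane, $$ {}_1F_1\big(a;b;b(1+b^{-1/2}\zeta)\big)=\frac{\Gamma(b)}{\Gamma(b-a)}\,b^{-a/2}\,e^{\zeta^2/4}\Big[D_{-a}(-\zeta)+\frac{A_1(a,\zeta)}{b^{1/2}}+\frac{A_2(a,\zeta)}{b}+O(b^{-3/2})\Big], $$ where $$A_1(a,\zeta)=a(a+1)D_{-a-1}(-\zeta)-\frac{a(a+1)(a+2)}{3}D_{-a-3}(-\zeta),$$ $$A_2(a,\zeta)=\frac{a(a+1)^2(a+2)}{2}D_{-a-2}(-\zeta)-\frac{\Gamma(a+4)}{\Gamma(a)}\Big(\frac14+\frac{a+1}{3}\Big)D_{-a-4}(-\zeta)+\frac{\Gamma(a+6)}{18\,\Gamma(a)}D_{-a-6}(-\zeta).$$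
   Context: ${}_1F_1(a;b;z)=\sum_{k=0}^\infty \frac{(a)_k}{(b)_k}\frac{z^k}{k!}$ is Kummer's confluent hypergeometric function, with $(x)_k=\Gamma(x+k)/\Gamma(x)$. $D_\nu$ denotes the parabolic cylinder function, given for $\mathrm{Re}\,\nu<0$ by $D_\nu(z)=\frac{e^{-z^2/4}}{\Gamma(-\nu)}\int_0^\infty e^{-zs-s^2/2}s^{-\nu-1}\,ds$. *)

(* Defs.v *)
From Stdlib Require Import Reals Factorial.
From Coquelicot Require Import Coquelicot.
Open Scope R_scope.

Definition Gamma (x : R) : R :=
  RInt_gen (fun t => Rpower t (x - 1) * exp (- t))
           (at_right 0) (Rbar_locally p_infty).

Fixpoint poch (x : R) (k : nat) : R :=
  match k with
  | O => 1
  | S k' => poch x k' * (x + INR k')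
  end.

Definition Cexp (z : C) : C :=
  (exp (fst z) * cos (snd z), exp (fst z) * sin (snd z)).

Definition hyp1F1_term (a b : R) (z : C) (k : nat) : C :=
  (RtoC (poch a k / (poch b k * INR (fact k))) * z ^ k)%C.

Definition hyp1F1 (a b : R) (z : C) : C :=
  (Series (fun k => fst (hyp1F1_term a b z k)),
   Series (fun k => snd (hyp1F1_term a b z k))).

(* Parabolic cylinder function, for Re nu < 0 (here nu real, nu < 0):
   D_nu(z) = e^{-z^2/4}/Gamma(-nu) * int_0^oo e^{-z s - s^2/2} s^{-nu-1} ds. *)
Definition PCF (nu : R) (z : C) : C :=
  (Cexp (- (z * z) / RtoC 4) / RtoC (Gamma (- nu)) *
  @RInt_gen C_R_CompleteNormedModule (fun s : R =>
              Cexp (- (z * RtoC s) - RtoC (s * s / 2)) * RtoC (Rpower s (- nu - 1)))%C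
           (at_right 0) (Rbar_locally p_infty))%C.

Definition B6_A1 (a : R) (zeta : C) : C :=
  (RtoC (a * (a + 1)) * PCF (- a - 1) (- zeta)
  - RtoC (a * (a + 1) * (a + 2) / 3) * PCF (- a - 3) (- zeta))%C.

Definition B6_A2 (a : R) (zeta : C) : C :=
  (RtoC (a * (a + 1) ^ 2 * (a + 2) / 2) * PCF (- a - 2) (- zeta)
  - RtoC (Gamma (a + 4) / Gamma a * (1 / 4 + (a + 1) / 3)) * PCF (- a - 4) (- zeta)
  + RtoC (Gamma (a + 6) / (18 * Gamma a)) * PCF (- a - 6) (- zeta))%C.

(* Main.v *)
Require Import Defs.
From Stdlib Require Import Reals Lra Lia Psatz Factorial.
From Coquelicot Require Import Coquelicot.
Open Scope R_scope.

(** Euler's integral represents [hyp1F1 a b z], with [z = b (1 + e zeta)] and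
    [e = b^(-1/2)], as [Gamma b / (Gamma a * Gamma (b - a)) * e^a] times the integral over
    [s > 0] of [s^(a-1) e^(zeta s) g s], where [g s = e^(s/e) (1 - e s)_+^(b-a-1)].
    Expanding [ln (1 - e s)] gives [g s = e^(-s^2/2) (1 + e d1 + e^2 (d2 + d1^2 / 2) + O(e^3 (1+s)^9))]
    uniformly in [s > 0]; integrating against [s^(a-1) e^(zeta s)] turns each monomial [s^k] into
    [Gamma (a + k) e^(zeta^2/4) D_(-a-k)(-zeta)].  The constant [Gamma a * Gamma c / Gamma (a + c)] of
    the Beta integral is obtained without Fubini, from log-convexity as in the Bohr-Mollerup theorem. *)

(** * Integrals over the positive half-line *)

(** The scale [s] is forced by [b * e = / e] and [b * e ^ 2 = 1]: under [u = e s] the exponent [z u]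
    of Euler's integral becomes [s / e + zeta s], and the linear term of [b ln (1 - e s)] cancels
    [s / e], so that the quadratic one leaves the Gaussian. The obstacle is uniformity in [s], since
    the logarithm is expanded only for [e s <= 1 / 2]. The error is nevertheless kept relative to
    the Gaussian everywhere: for larger [s] one has [1 <= 2 e (1 + s)], so each term can be raised
    to order [e ^ 3] at the price of powers of [1 + s]. The exponent 9 is three times 3, from the
    cube of an exponent whose first-order term has degree 3 in [s]. A bound relative to the Gaussian
    survives the factor [e^(zeta s)] for all [|zeta| <= r] at once. The integrals are improper
    Riemann integrals, so convergence is proved along with each value; a multiple of the Gamma
    integrand dominates the moments and the Laplace integrals. Extending the Beta weight by zero
    puts all of them on the same half-line. *)

Notation is_pint f l :=
  (is_RInt_gen f (at_right 0) (Rbar_locally p_infty) l).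
Notation ex_pint f :=
  (ex_RInt_gen f (at_right 0) (Rbar_locally p_infty)).

Lemma eventually_pos_bounds :
  filter_prod (at_right 0) (Rbar_locally p_infty)
    (fun ab : R * R => 0 < fst ab <= snd ab).
Proof.
apply (Filter_prod _ _ _ (fun x => 0 < x < 1) (fun y => 1 < y)).
- exists (mkposreal 1 Rlt_0_1). intros y Hy H0. split; [exact H0|].
  change (Rabs (y - 0) < 1) in Hy. apply Rabs_def2 in Hy. lra.
- exists 1. intros; assumption.
- intros x y Hx Hy; simpl; lra.
Qed.

Lemma ex_RInt_pos {V : CompleteNormedModule R_AbsRing} (f : R -> V) (a b : R) :
  (forall x, 0 < x -> continuous f x) -> 0 < a -> 0 < b -> ex_RInt f a b.
Proof.
intros Hf Ha Hb. apply (ex_RInt_continuous (V := V)). intros z Hz. apply Hf.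
revert Hz. unfold Rmin. destruct (Rle_dec a b); lra.
Qed.

Lemma norm_RInt_dominated {V : CompleteNormedModule R_AbsRing}
    (f : R -> V) (g : R -> R) (a b : R) (lf : V) (lg : R) :
  (forall x, 0 < x -> norm (f x) <= g x) -> 0 < a -> 0 < b ->
  is_RInt f a b lf -> is_RInt g a b lg -> norm lf <= Rabs lg.
Proof.
intros Hle Ha Hb Hf Hg.
destruct (Rle_dec a b) as [Hab|Hab].
- apply Rle_trans with lg; [|apply Rle_abs].
  apply (norm_RInt_le f g a b lf lg); auto. intros x Hx; apply Hle; lra.
- apply is_RInt_swap in Hf. apply is_RInt_swap in Hg.
  rewrite <- norm_opp. rewrite <- (Rabs_Ropp lg).
  apply Rle_trans with (opp lg); [|apply Rle_abs].
  apply (norm_RInt_le f g b a); auto; try lra. intros x Hx; apply Hle; lra.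
Qed.

(** Cauchy criterion over pairs of bounds: the bounds are moved from [(a, b)] to [(a', b')] one at a
    time, and each move changes the integral of [f] by at most the change in the integral of [g]. *)
Lemma ex_pint_dominated {V : CompleteNormedModule R_AbsRing}
    (f : R -> V) (g : R -> R) :
  (forall x, 0 < x -> continuous f x) ->
  (forall x, 0 < x -> continuous g x) ->
  (forall x, 0 < x -> norm (f x) <= g x) ->
  ex_pint g -> ex_pint f.
Proof.
intros Hf Hg Hle Hex.
assert (Hw : forall h : R -> V, (forall x, 0 < x -> continuous h x) ->
  filter_prod (at_right 0) (Rbar_locally p_infty) (fun ab : R * R =>
    (exists y, is_RInt h (fst ab) (snd ab) y) /\
    (forall y1 y2, is_RInt h (fst ab) (snd ab) y1 ->
       is_RInt h (fst ab) (snd ab) y2 -> y1 = y2))).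
{ intros h Hh. generalize eventually_pos_bounds. apply filter_imp.
  intros [a b]; simpl; intros [H1 H2]. split.
  - apply (ex_RInt_pos h); auto; lra.
  - intros y1 y2 E1 E2.
    apply is_RInt_unique in E1. apply is_RInt_unique in E2. congruence. }
destruct Hex as [lg Hlg].
apply (proj1 (filterlimi_locally_cauchy _ (Hw f Hf))).
intros eps.
unfold is_RInt_gen in Hlg.
pose proof (proj1 (filterlimi_locally _ _) Hlg) as HL.
(* Three integrals of [g] will lie within [eps / 4] of [lg], so consecutive ones differ by less than
   [eps / 2]. *)
assert (He : 0 < eps / 4) by (destruct eps; simpl; lra).
destruct (HL (mkposreal _ He)) as [P Q HP HQ HPQ].
exists (fun ab => (P (fst ab) /\ Q (snd ab)) /\ 0 < fst ab <= snd ab).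
split.
{ apply filter_and; [|exact eventually_pos_bounds].
  apply (Filter_prod _ _ _ P Q); auto. }
intros [a b] [a' b']; simpl.
intros [[Pa Qb] Hab] [[Pa' Qb'] Hab'] u v Hu Hv.
destruct (HPQ a b Pa Qb) as [z1 [I1 B1]].
destruct (HPQ a' b Pa' Qb) as [z2 [I2 B2]].
destruct (HPQ a' b' Pa' Qb') as [z3 [I3 B3]].
simpl in I1, I2, I3.
change (Rabs (z1 - lg) < eps / 4) in B1.
change (Rabs (z2 - lg) < eps / 4) in B2.
change (Rabs (z3 - lg) < eps / 4) in B3.
apply Rabs_def2 in B1. apply Rabs_def2 in B2. apply Rabs_def2 in B3.
destruct (ex_RInt_pos f a' b Hf) as [w Hw']; try lra.
assert (Hd1 : norm (minus w u) <= Rabs (z2 - z1)).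
{ apply (norm_RInt_dominated f g a' a); auto; try lra.
  - replace (minus w u) with (plus w (opp u)) by reflexivity.
    apply (is_RInt_Chasles (V := V) f a' b a); auto. apply (is_RInt_swap (V := V)); auto.
  - replace (z2 - z1) with (plus z2 (opp z1)) by reflexivity.
    apply (is_RInt_Chasles g a' b a); auto.
    apply is_RInt_swap; auto. }
assert (Hd2 : norm (minus v w) <= Rabs (z3 - z2)).
{ apply (norm_RInt_dominated f g b b'); auto; try lra.
  - replace (minus v w) with (plus (opp w) v).
    2: unfold minus; apply plus_comm.
    apply (is_RInt_Chasles (V := V) f b a' b'); auto. apply (is_RInt_swap (V := V)); auto.
  - replace (z3 - z2) with (plus (opp z2) z3).
    2: unfold plus, opp; simpl; ring.
    apply (is_RInt_Chasles g b a' b'); auto.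
    apply is_RInt_swap; auto. }
apply (norm_compat1 (V := V)).
assert (E : minus v u = plus (minus v w) (minus w u)).
{ unfold minus. rewrite plus_assoc. f_equal. rewrite <- plus_assoc.
  rewrite plus_opp_l. symmetry; apply plus_zero_r. }
change (norm (minus v u) < eps). rewrite E.
apply Rle_lt_trans with (norm (minus v w) + norm (minus w u)).
{ apply (norm_triangle (V := V) (minus v w) (minus w u)). }
assert (Rabs (z2 - z1) < eps / 2) by (apply Rabs_def1; lra).
assert (Rabs (z3 - z2) < eps / 2) by (apply Rabs_def1; lra).
apply Rle_lt_trans with (Rabs (z3 - z2) + Rabs (z2 - z1)); [|lra].
apply Rplus_le_compat; [exact Hd2|exact Hd1].
Qed.

Lemma is_pint_norm_le {V : CompleteNormedModule R_AbsRing}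
    (f : R -> V) (g : R -> R) (lf : V) (lg : R) :
  (forall x, 0 < x -> norm (f x) <= g x) ->
  is_pint f lf -> is_pint g lg -> norm lf <= lg.
Proof.
intros Hle Hf Hg.
refine (RInt_gen_norm f g lf lg _ _ Hf Hg).
- generalize eventually_pos_bounds. apply filter_imp. intros; lra.
- generalize eventually_pos_bounds. apply filter_imp.
  intros [a b] H x Hx; simpl in *. apply Hle; lra.
Qed.

Lemma is_pint_le (f g : R -> R) (lf lg : R) :
  (forall x, 0 < x -> f x <= g x) ->
  is_pint f lf -> is_pint g lg -> lf <= lg.
Proof.
intros Hle Hf Hg.
assert (Hd := is_RInt_gen_minus _ _ _ _ Hg Hf).
assert (H : 0 <= minus lg lf).
{ apply Rle_trans with (norm (minus lg lf)); [apply norm_ge_0|].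
  apply (is_pint_norm_le (V := R_CompleteNormedModule)
    (fun x => minus (g x) (f x)) (fun x => minus (g x) (f x))); auto.
  intros x Hx. specialize (Hle x Hx). unfold minus, plus, opp, norm; simpl.
  unfold abs; simpl. rewrite Rabs_pos_eq; lra. }
unfold minus, plus, opp in H; simpl in H. lra.
Qed.

Lemma is_pint_ext {V : NormedModule R_AbsRing} (f g : R -> V) (l : V) :
  (forall x, 0 < x -> f x = g x) -> is_pint f l -> is_pint g l.
Proof.
intros H. apply is_RInt_gen_ext.
generalize eventually_pos_bounds. apply filter_imp.
intros [a b] Hab x Hx; simpl in *. apply H.
rewrite Rmin_left in Hx; lra.
Qed.

Lemma is_pint_unique {V : CompleteNormedModule R_AbsRing} (f : R -> V) (l l' : V) :
  is_pint f l -> is_pint f l' -> l = l'.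
Proof.
intros H H'.
rewrite <- (is_RInt_gen_unique f l H).
apply (is_RInt_gen_unique f l' H').
Qed.

Lemma is_pint_derive (F f : R -> R) (l0 l1 : R) :
  (forall x, 0 < x -> is_derive F x (f x)) ->
  (forall x, 0 < x -> continuous f x) ->
  filterlim F (at_right 0) (locally l0) ->
  filterlim F (Rbar_locally p_infty) (locally l1) ->
  is_pint f (l1 - l0).
Proof.
intros HF Hf H0 H1.
apply (is_pint_ext (Derive F)).
{ intros x Hx. apply is_derive_unique; auto. }
apply is_RInt_gen_Derive; auto.
- generalize eventually_pos_bounds. apply filter_imp.
  intros [a b] Hab x Hx; simpl in *. rewrite Rmin_left in Hx by lra.
  exists (f x). apply HF; lra.
- generalize eventually_pos_bounds. apply filter_imp.
  intros [a b] Hab x Hx; simpl in *. rewrite Rmin_left in Hx by lra.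
  apply (continuous_ext_loc _ f).
  + assert (Hp : 0 < x) by lra. exists (mkposreal x Hp). intros y Hy.
    change (Rabs (y - x) < x) in Hy. apply Rabs_def2 in Hy.
    symmetry; apply is_derive_unique, HF; lra.
  + apply Hf; lra.
Qed.

(** The integral over [[1/4, 1/2]] is a fixed positive lower bound for the integrals over all larger
    intervals, hence for their limit. *)
Lemma is_pint_pos (f : R -> R) (l : R) :
  (forall x, 0 < x -> 0 <= f x) -> (forall x, 0 < x < 1 -> 0 < f x) ->
  (forall x, 0 < x -> continuous f x) -> is_pint f l -> 0 < l.
Proof.
intros H0 H1 Hc Hf.
set (J := RInt f (1/4) (1/2)).
assert (HJ : 0 < J).
{ apply RInt_gt_0; try lra.
  - intros x Hx; apply H1; lra.
  - intros x Hx; apply Hc; lra. }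
apply Rlt_le_trans with J; auto.
destruct (Rle_lt_dec J l) as [|Hlt]; auto. exfalso.
pose proof (proj1 (filterlimi_locally _ _) Hf) as HL.
assert (He : 0 < J - l) by lra.
specialize (HL (mkposreal _ He)).
assert (HQ : filter_prod (at_right 0) (Rbar_locally p_infty)
    (fun ab : R * R => 0 < fst ab <= 1/4 /\ 1/2 <= snd ab)).
{ apply (Filter_prod _ _ _ (fun x => 0 < x < 1/4) (fun y => 1/2 < y)).
- assert (Hq : 0 < 1/4) by lra. exists (mkposreal _ Hq). intros y Hy Hy0. split; [exact Hy0|].
  change (Rabs (y - 0) < 1/4) in Hy. apply Rabs_def2 in Hy. lra.
- exists (1/2). intros; assumption.
- intros x y Hx Hy; simpl; lra. }
destruct (filter_ex _ (filter_and _ _ HL HQ)) as [[a b] [[z [Hz Bz]] [Ha Hb]]].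
simpl in *.
change (Rabs (z - l) < J - l) in Bz. apply Rabs_def2 in Bz.
assert (Hex : forall u v, 0 < u -> 0 < v -> ex_RInt f u v).
{ intros; apply (ex_RInt_pos (V := R_CompleteNormedModule) f); auto. }
apply (is_RInt_unique (V := R_CompleteNormedModule)) in Hz.
assert (E : z = RInt f a (1/4) + J + RInt f (1/2) b).
{ unfold J. rewrite <- Hz.
  rewrite <- (RInt_Chasles f a (1/2) b) by (apply Hex; lra).
  rewrite <- (RInt_Chasles f a (1/4) (1/2)) by (apply Hex; lra).
  reflexivity. }
assert (0 <= RInt f a (1/4)).
{ apply RInt_ge_0; try lra. apply Hex; lra. intros; apply H0; lra. }
assert (0 <= RInt f (1/2) b).
{ apply RInt_ge_0; try lra. apply Hex; lra. intros; apply H0; lra. }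
lra.
Qed.

(** * Moments and the Gamma function *)

Lemma exp_le (x y : R) : x <= y -> exp x <= exp y.
Proof.
intros [H| ->]; [left; apply exp_increasing; auto | right; auto].
Qed.

Lemma ln_le_sub1 (y : R) : 0 < y -> ln y <= y - 1.
Proof.
intros Hy. pose proof (exp_ineq1_le (ln y)) as H.
rewrite exp_ln in H by auto. lra.
Qed.

Lemma is_derive_Rpower (x t : R) : 0 < t ->
  is_derive (fun s => Rpower s x) t (x * Rpower t (x - 1)).
Proof.
intros Ht. apply is_derive_Reals.
exact (derivable_pt_lim_power t x Ht).
Qed.

Lemma continuous_Rpower (x t : R) : 0 < t ->
  continuous (fun s => Rpower s x) t.
Proof.
intros Ht. apply (ex_derive_continuous (V := R_NormedModule)).
eexists. apply is_derive_Rpower; auto.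
Qed.

Lemma Rpower_pos (t x : R) : 0 < Rpower t x.
Proof. apply exp_pos. Qed.

Lemma Rpower_le_exp (x : R) : 0 < x ->
  exists C, 0 < C /\ forall t, 0 < t -> Rpower t x <= C * exp (t / 4).
Proof.
(* The exponent is the maximum of [x ln t - t / 4], attained at [t = 4 x]. *)
intros Hx. exists (exp (x * (ln (4 * x) - 1))). split; [apply exp_pos|].
intros t Ht. unfold Rpower. rewrite <- exp_plus.
apply exp_le.
assert (H : ln (t / (4 * x)) <= t / (4 * x) - 1).
{ apply ln_le_sub1. apply Rdiv_lt_0_compat; lra. }
rewrite ln_div in H by lra.
apply Rmult_le_compat_l with (r := x) in H; [|lra].
replace (x * (t / (4 * x) - 1)) with (t / 4 - x) in H by (field; lra).
lra.
Qed.

Lemma filterlim_Rpower_0 (x : R) : 0 < x ->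
  forall eps, 0 < eps -> at_right 0 (fun t => 0 < t /\ Rpower t x < eps).
Proof.
intros Hx eps He.
assert (Hd : 0 < Rpower eps (/ x)) by apply Rpower_pos.
exists (mkposreal _ Hd). intros t Ht H0. split; auto.
change (Rabs (t - 0) < Rpower eps (/ x)) in Ht.
apply Rabs_def2 in Ht.
replace eps with (Rpower (Rpower eps (/ x)) x).
- unfold Rpower at 1 2. apply exp_increasing, Rmult_lt_compat_l; auto.
  apply ln_increasing; lra.
- rewrite Rpower_mult, Rinv_l, Rpower_1; lra.
Qed.

(** Supplies the vanishing boundary terms of the integration by parts in [moment_by_parts]. *)
Lemma weighted_power_limits (w : R -> R) (K x : R) : 0 < x ->
  (forall t, 0 < t -> Rabs (w t) <= K * exp (- t)) ->
  filterlim (fun t => Rpower t x * w t) (at_right 0) (locally 0) /\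
  filterlim (fun t => Rpower t x * w t) (Rbar_locally p_infty) (locally 0).
Proof.
intros Hx Hw.
assert (HK : 0 <= K).
{ pose proof (Hw 1 Rlt_0_1). pose proof (Rabs_pos (w 1)).
  pose proof (exp_pos (- (1))). nra. }
destruct (Rpower_le_exp x Hx) as [C [HC Hp]].
split; apply filterlim_locally; intros eps; destruct eps as [e He].
- assert (Hq : 0 < e / (K + 1)) by (apply Rdiv_lt_0_compat; lra).
  generalize (filterlim_Rpower_0 x Hx _ Hq). apply filter_imp.
  intros t [H0 Ht].
  change (Rabs (Rpower t x * w t - 0) < e).
  rewrite Rminus_0_r, Rabs_mult, (Rabs_pos_eq (Rpower t x)) by (left; apply Rpower_pos).
  assert (Rabs (w t) <= K).
  { apply Rle_trans with (1 := Hw t H0).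
    assert (exp (- t) <= 1) by (rewrite <- exp_0; apply exp_le; lra). nra. }
  apply Rle_lt_trans with (Rpower t x * K).
  + apply Rmult_le_compat_l; auto. left; apply Rpower_pos.
  + apply Rle_lt_trans with (e / (K + 1) * K).
    * apply Rmult_le_compat_r; lra.
    * apply Rmult_lt_reg_r with (K + 1); [lra|].
      replace (e / (K + 1) * K * (K + 1)) with (e * K) by (field; lra). lra.
- exists (Rmax 1 (2 * K * C / e)). intros t Ht.
  assert (H1 : 1 < t) by (apply Rle_lt_trans with (2 := Ht); apply Rmax_l).
  assert (H2 : 2 * K * C / e < t) by (apply Rle_lt_trans with (2 := Ht); apply Rmax_r).
  change (Rabs (Rpower t x * w t - 0) < e).
  rewrite Rminus_0_r, Rabs_mult, (Rabs_pos_eq (Rpower t x)) by (left; apply Rpower_pos).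
  apply Rle_lt_trans with (C * exp (t / 4) * (K * exp (- t))).
  { apply Rmult_le_compat; try apply Rabs_pos. left; apply Rpower_pos.
    apply Hp; lra. apply Hw; lra. }
  replace (C * exp (t / 4) * (K * exp (- t))) with (K * C * exp (- (3 / 4 * t))).
  2:{ replace (- (3 / 4 * t)) with (t / 4 + - t) by field. rewrite exp_plus; ring. }
  rewrite exp_Ropp.
  assert (t / 2 < exp (3 / 4 * t)).
  { pose proof (exp_ineq1_le (3 / 4 * t)); lra. }
  apply Rle_lt_trans with (K * C * / (t / 2)).
  { apply Rmult_le_compat_l. nra. apply Rinv_le_contravar; lra. }
  apply Rmult_lt_reg_r with (t / e); [apply Rdiv_lt_0_compat; lra|].
  replace (K * C * / (t / 2) * (t / e)) with (2 * K * C / e) by (field; lra).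
  replace (e * (t / e)) with t by (field; lra). lra.
Qed.

(** One majorant serves both ends: the derivative of [- / (1 + t^x)] behaves like [t^(x-1)] at 0,
    and its integral is known from the limits of the antiderivative. Domination amounts to
    [exp (- t) * (1 + t^x) ^ 2 <= (1 + C) ^ 2], where each factor [1 + t^x] costs only
    [exp (t / 4)]. *)
Lemma ex_pint_Gamma (x : R) : 0 < x ->
  ex_pint (fun t => Rpower t (x - 1) * exp (- t)).
Proof.
intros Hx.
destruct (Rpower_le_exp x Hx) as [C [HC Hp]].
set (F := fun t => - / (1 + Rpower t x)).
set (f := fun t => x * Rpower t (x - 1) / (1 + Rpower t x) ^ 2).
assert (Hp1 : forall t, 0 < 1 + Rpower t x).
{ intros t. pose proof (Rpower_pos t x). lra. }
assert (HF : forall t, 0 < t -> is_derive F t (f t)).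
{ intros t Ht. unfold F, f.
  replace (x * Rpower t (x - 1) / (1 + Rpower t x) ^ 2)
    with (opp (- (plus 0 (x * Rpower t (x - 1))) / (1 + Rpower t x) ^ 2)).
  2:{ unfold opp, plus; simpl. field. specialize (Hp1 t); lra. }
  apply (is_derive_opp (fun t => / (1 + Rpower t x))).
  apply (is_derive_inv (fun t => 1 + Rpower t x)).
  - apply (is_derive_plus (fun _ => 1) (fun t => Rpower t x)).
    + apply (is_derive_const (V := R_NormedModule)).
    + exact (is_derive_Rpower x t Ht).
  - specialize (Hp1 t); lra. }
assert (Hcf : forall t, 0 < t -> continuous f t).
{ intros t Ht. unfold f.
  apply (continuous_mult (K := R_AbsRing) (fun t => x * Rpower t (x - 1)) (fun t => / (1 + Rpower t x) ^ 2)).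
  - apply (continuous_scal_r (K := R_AbsRing) (V := R_NormedModule) x (fun t => Rpower t (x - 1))).
    apply continuous_Rpower; auto.
  - apply continuous_Rinv_comp.
    + apply (ex_derive_continuous (V := R_NormedModule)).
      apply (ex_derive_pow (fun t => 1 + Rpower t x)).
      apply (ex_derive_plus (fun _ => 1) (fun t => Rpower t x)).
      apply ex_derive_const. eexists; apply is_derive_Rpower; auto.
    + apply pow_nonzero. specialize (Hp1 t); lra. }
assert (HI : is_pint f (0 - (- 1))).
{ apply (is_pint_derive F f); auto.
  - apply filterlim_locally; intros [e He].
    generalize (filterlim_Rpower_0 x Hx e He). apply filter_imp.
    intros t [Ht H]. change (Rabs (- / (1 + Rpower t x) - - 1) < e).
    replace (- / (1 + Rpower t x) - - 1) with (Rpower t x / (1 + Rpower t x)).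
    2:{ field. specialize (Hp1 t); lra. }
    pose proof (Rpower_pos t x).
    rewrite Rabs_pos_eq. 2:{ apply Rlt_le, Rdiv_lt_0_compat; lra. }
    apply Rle_lt_trans with (Rpower t x); auto.
    apply Rmult_le_reg_r with (1 + Rpower t x); [lra|].
    unfold Rdiv; rewrite Rmult_assoc, Rinv_l; nra.
  - apply filterlim_locally; intros [e He].
    exists (Rmax 1 (Rpower (/ e) (/ x))). intros t Ht.
    assert (H1 : 1 < t) by (apply Rle_lt_trans with (2 := Ht); apply Rmax_l).
    assert (H2 : Rpower (/ e) (/ x) < t) by (apply Rle_lt_trans with (2 := Ht); apply Rmax_r).
    change (Rabs (- / (1 + Rpower t x) - 0) < e).
    rewrite Rminus_0_r, Rabs_Ropp, Rabs_pos_eq.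
    2:{ left; apply Rinv_0_lt_compat; auto. }
    assert (Hie : 0 < / e) by (apply Rinv_0_lt_compat; auto).
    assert (/ e < Rpower t x).
    { replace (/ e) with (Rpower (Rpower (/ e) (/ x)) x).
      - unfold Rpower at 1 3. apply exp_increasing, Rmult_lt_compat_l; auto.
        apply ln_increasing; auto. apply Rpower_pos.
      - rewrite Rpower_mult, Rinv_l, Rpower_1; lra. }
    rewrite <- (Rinv_inv e). apply Rinv_lt_contravar; [|lra].
    apply Rmult_lt_0_compat; lra. }
set (K := (1 + C) ^ 2 / x).
apply (ex_pint_dominated (V := R_CompleteNormedModule) _ (fun t => K * f t)).
- intros t Ht. apply (continuous_mult (K := R_AbsRing) (fun t => Rpower t (x - 1)) (fun t => exp (- t))).
  + apply continuous_Rpower; auto.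
  + apply (ex_derive_continuous (V := R_NormedModule)). auto_derive; auto.
- intros t Ht. apply (continuous_scal_r (K := R_AbsRing) (V := R_NormedModule) K f). auto.
- intros t Ht. change (Rabs (Rpower t (x - 1) * exp (- t)) <= K * f t).
  pose proof (Rpower_pos t x). pose proof (Rpower_pos t (x - 1)). pose proof (exp_pos (- t)).
  rewrite Rabs_pos_eq by (apply Rmult_le_pos; lra).
  unfold K, f.
  replace ((1 + C) ^ 2 / x * (x * Rpower t (x - 1) / (1 + Rpower t x) ^ 2))
    with (Rpower t (x - 1) * ((1 + C) ^ 2 / (1 + Rpower t x) ^ 2)) by (field; lra).
  apply Rmult_le_compat_l; [lra|].
  apply Rmult_le_reg_r with ((1 + Rpower t x) ^ 2); [apply pow_lt; lra|].
  replace ((1 + C) ^ 2 / (1 + Rpower t x) ^ 2 * (1 + Rpower t x) ^ 2) with ((1 + C) ^ 2) by (field; lra).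
  assert (H4 : 1 + Rpower t x <= (1 + C) * exp (t / 4)).
  { specialize (Hp t Ht). assert (1 <= exp (t / 4)) by (rewrite <- exp_0; apply exp_le; lra). lra. }
  apply Rle_trans with (exp (- t) * ((1 + C) * exp (t / 4)) ^ 2).
  { apply Rmult_le_compat_l; [lra|]. apply pow_incr. lra. }
  replace (exp (- t) * ((1 + C) * exp (t / 4)) ^ 2) with ((1 + C) ^ 2 * exp (- (t / 2))).
  2:{ replace (- (t / 2)) with (- t + t / 4 + t / 4) by field. rewrite !exp_plus. ring. }
  assert (exp (- (t / 2)) <= 1) by (rewrite <- exp_0; apply exp_le; lra).
  assert (0 < (1 + C) ^ 2) by (apply pow_lt; lra). nra.
- exists (scal K (0 - (-1))).
  apply (is_RInt_gen_scal (V := R_NormedModule)). exact HI.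
Qed.

Lemma Gamma_correct (x : R) : 0 < x ->
  is_pint (fun t => Rpower t (x - 1) * exp (- t)) (Gamma x).
Proof.
intros Hx. apply (RInt_gen_correct (V := R_CompleteNormedModule)).
apply ex_pint_Gamma; auto.
Qed.

Lemma ex_pint_moment {V : CompleteNormedModule R_AbsRing} (f : R -> V) (K x : R) :
  0 < x -> (forall t, 0 < t -> continuous f t) ->
  (forall t, 0 < t -> norm (f t) <= K * (Rpower t (x - 1) * exp (- t))) ->
  ex_pint f.
Proof.
intros Hx Hc Hle.
apply (ex_pint_dominated f (fun t => K * (Rpower t (x - 1) * exp (- t)))); auto.
- intros t Ht.
  apply (continuous_scal_r (K := R_AbsRing) (V := R_NormedModule) K (fun t => Rpower t (x - 1) * exp (- t))).
  apply (continuous_mult (K := R_AbsRing) (fun t => Rpower t (x - 1)) (fun t => exp (- t))).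
  + apply continuous_Rpower; auto.
  + apply (ex_derive_continuous (V := R_NormedModule)). auto_derive; auto.
- exists (scal K (Gamma x)).
  apply (is_RInt_gen_scal (V := R_NormedModule)). apply Gamma_correct; auto.
Qed.

(** The Mellin transform of [w] at [x], stated as a relation so that a value always comes with the
    convergence of its integral. *)
Definition is_moment (w : R -> R) (x m : R) : Prop :=
  is_pint (fun t => Rpower t (x - 1) * w t) m.

Lemma is_moment_exists (w : R -> R) (K x : R) : 0 < x ->
  (forall t, 0 < t -> continuous w t) ->
  (forall t, 0 < t -> Rabs (w t) <= K * exp (- t)) ->
  exists m, is_moment w x m.
Proof.
intros Hx Hc Hw. apply (ex_pint_moment (V := R_CompleteNormedModule) _ K x Hx).
- intros t Ht. apply (continuous_mult (K := R_AbsRing) (fun t => Rpower t (x - 1)) w); auto.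
  apply continuous_Rpower; auto.
- intros t Ht. change (Rabs (Rpower t (x - 1) * w t) <= K * (Rpower t (x - 1) * exp (- t))).
  pose proof (Rpower_pos t (x - 1)).
  rewrite Rabs_mult, (Rabs_pos_eq (Rpower t (x - 1))) by lra.
  specialize (Hw t Ht). nra.
Qed.

Lemma is_moment_pos (w : R -> R) (x m : R) :
  (forall t, 0 < t -> 0 <= w t) -> (forall t, 0 < t < 1 -> 0 < w t) ->
  (forall t, 0 < t -> continuous w t) -> is_moment w x m -> 0 < m.
Proof.
intros H0 H1 Hc Hm. apply (is_pint_pos (fun t => Rpower t (x - 1) * w t)); auto.
- intros t Ht. apply Rmult_le_pos; auto. left; apply Rpower_pos.
- intros t Ht. apply Rmult_lt_0_compat; auto. apply Rpower_pos.
- intros t Ht. apply (continuous_mult (K := R_AbsRing) (fun t => Rpower t (x - 1)) w); auto.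
  apply continuous_Rpower; auto.
Qed.

(** Weighted arithmetic-geometric inequality for [y = t / l] and 1. With [v] the arithmetic mean,
    [ln x <= x - 1] is used at [y / v] and at [1 / v]; weighted by [h] and [1 - h], the right sides
    add up to 0. *)
Lemma young_Rpower (t l h : R) : 0 < t -> 0 < l -> 0 <= h <= 1 ->
  Rpower t h <= Rpower l h * (1 - h + h * (t / l)).
Proof.
intros Ht Hl Hh.
set (y := t / l). assert (Hy : 0 < y) by (apply Rdiv_lt_0_compat; auto).
replace (Rpower t h) with (Rpower (l * y) h) by (f_equal; unfold y; field; lra).
rewrite <- Rpower_mult_distr by auto.
apply Rmult_le_compat_l; [left; apply Rpower_pos|].
set (v := 1 - h + h * y). assert (Hv : 0 < v) by (unfold v; nra).
rewrite <- (exp_ln v Hv). unfold Rpower. apply exp_le.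
assert (E1 : ln (y / v) <= y / v - 1) by (apply ln_le_sub1, Rdiv_lt_0_compat; auto).
assert (E2 : ln (1 / v) <= 1 / v - 1) by (apply ln_le_sub1, Rdiv_lt_0_compat; lra).
rewrite ln_div in E1, E2 by lra. rewrite ln_1 in E2.
assert (E : h * (y / v - 1) + (1 - h) * (1 / v - 1) = 0).
{ replace (h * (y / v - 1) + (1 - h) * (1 / v - 1)) with ((1 - h + h * y - v) / v) by (field; lra).
  unfold v; unfold Rdiv; ring. }
assert (h * (ln y - ln v) <= h * (y / v - 1)) by (apply Rmult_le_compat_l; lra).
assert ((1 - h) * (0 - ln v) <= (1 - h) * (1 / v - 1)) by (apply Rmult_le_compat_l; lra).
lra.
Qed.

(* The optimal scale in Young's inequality is [m1 / m0]. *)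
Lemma moment_log_convex (w : R -> R) (x h m0 m1 mh : R) :
  (forall t, 0 < t -> 0 <= w t) -> 0 <= h <= 1 -> 0 < m0 -> 0 < m1 ->
  is_moment w x m0 -> is_moment w (x + 1) m1 -> is_moment w (x + h) mh ->
  mh <= Rpower (m1 / m0) h * m0.
Proof.
intros Hw Hh P0 P1 H0 H1 Hmh.
set (l := m1 / m0). assert (Hl : 0 < l) by (apply Rdiv_lt_0_compat; auto).
replace (Rpower l h * m0) with
  (plus (scal (Rpower l h * (1 - h)) m0) (scal (Rpower l h * h / l) m1)).
2:{ unfold plus, scal; simpl; unfold mult; simpl. unfold l; field; lra. }
refine (is_pint_le _ _ _ _ _ Hmh
  (is_RInt_gen_plus _ _ _ _ (is_RInt_gen_scal _ _ _ H0) (is_RInt_gen_scal _ _ _ H1))).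
intros t Ht. unfold plus, scal; simpl; unfold mult; simpl.
replace (x + h - 1) with (x - 1 + h) by ring.
replace (x + 1 - 1) with (x - 1 + 1) by ring.
rewrite !Rpower_plus, Rpower_1 by auto.
pose proof (young_Rpower t l h Ht Hl Hh) as Hy.
specialize (Hw t Ht). pose proof (Rpower_pos t (x - 1)).
apply Rle_trans with (Rpower t (x - 1) * (Rpower l h * (1 - h + h * (t / l))) * w t).
- apply Rmult_le_compat_r; auto. apply Rmult_le_compat_l; lra.
- right. unfold Rdiv. ring.
Qed.

(** The integrand is the derivative of [t^x * w t], which vanishes at both ends. The functional
    equations of Gamma and of the Beta integral are both instances. *)
Lemma moment_by_parts (w w' : R -> R) (K x : R) : 0 < x ->
  (forall t, 0 < t -> is_derive w t (w' t)) ->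
  (forall t, 0 < t -> continuous w' t) ->
  (forall t, 0 < t -> Rabs (w t) <= K * exp (- t)) ->
  is_pint (fun t => x * Rpower t (x - 1) * w t + Rpower t x * w' t) 0.
Proof.
intros Hx Hd Hc Hb.
destruct (weighted_power_limits w K x Hx Hb) as [L0 L1].
replace (is_pint (fun t => x * Rpower t (x - 1) * w t + Rpower t x * w' t) 0)
  with (is_pint (fun t => x * Rpower t (x - 1) * w t + Rpower t x * w' t) (0 - 0))
  by (rewrite Rminus_0_r; reflexivity).
apply (is_pint_derive (fun t => Rpower t x * w t)); auto.
- intros t Ht. 
  apply (is_derive_mult (fun t => Rpower t x) w t); auto.
  + exact (is_derive_Rpower x t Ht).
  + intros; apply Rmult_comm.
- intros t Ht.
  apply (continuous_plus (fun t => x * Rpower t (x - 1) * w t) (fun t => Rpower t x * w' t)).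
  + apply (continuous_mult (K := R_AbsRing) (fun t => x * Rpower t (x - 1)) w).
    * apply (continuous_scal_r (K := R_AbsRing) (V := R_NormedModule) x (fun t => Rpower t (x - 1))).
      apply continuous_Rpower; auto.
    * apply (ex_derive_continuous (V := R_NormedModule)). eexists; apply Hd; auto.
  + apply (continuous_mult (K := R_AbsRing) (fun t => Rpower t x) w'); auto.
    apply continuous_Rpower; auto.
Qed.

Lemma continuous_exp_opp (t : R) : continuous (fun s => exp (- s)) t.
Proof. apply (ex_derive_continuous (V := R_NormedModule)). auto_derive; auto. Qed.

Lemma Gamma_pos (x : R) : 0 < x -> 0 < Gamma x.
Proof.
intros Hx. apply (is_moment_pos (fun t => exp (- t)) x).
- intros; left; apply exp_pos.
- intros; apply exp_pos.
- intros; apply continuous_exp_opp.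
- exact (Gamma_correct x Hx).
Qed.

Lemma Gamma_succ (x : R) : 0 < x -> Gamma (x + 1) = x * Gamma x.
Proof.
intros Hx.
assert (H : is_pint (fun t => x * Rpower t (x - 1) * exp (- t) + Rpower t x * (- exp (- t))) 0).
{ apply (moment_by_parts _ _ 1); auto.
  - intros t Ht. auto_derive; auto. ring.
  - intros t Ht. apply (continuous_opp (V := R_NormedModule)), continuous_exp_opp.
  - intros t Ht. rewrite Rabs_pos_eq; [lra|left; apply exp_pos]. }
assert (H' := is_RInt_gen_minus _ _ _ _ (is_RInt_gen_scal _ x _ (Gamma_correct x Hx))
  (Gamma_correct (x + 1) ltac:(lra))).
assert (E : minus (scal x (Gamma x)) (Gamma (x + 1)) = 0).
{ apply (is_pint_unique (V := R_CompleteNormedModule) _ _ _ H').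
  revert H. apply (is_pint_ext (V := R_NormedModule)). intros t Ht.
  unfold minus, plus, opp, scal; simpl; unfold mult; simpl.
  replace (x + 1 - 1) with x by ring. ring. }
unfold minus, plus, opp, scal in E; simpl in E; unfold mult in E; simpl in E. lra.
Qed.

Lemma Gamma_1 : Gamma 1 = 1.
Proof.
transitivity (0 - - (1)); [|ring].
apply (is_pint_unique (V := R_CompleteNormedModule) _ _ _ (Gamma_correct 1 Rlt_0_1)).
apply (is_pint_ext (V := R_NormedModule) (fun t => exp (- t))).
{ intros t Ht. replace (1 - 1) with 0 by ring. rewrite Rpower_O by auto. symmetry; apply Rmult_1_l. }
apply (is_pint_derive (fun t => - exp (- t))).
- intros t Ht. auto_derive; auto. ring.
- intros; apply continuous_exp_opp.
- assert (Hc : continuous (fun t => - exp (- t)) 0).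
  { apply (continuous_opp (V := R_NormedModule) (fun t => exp (- t))), continuous_exp_opp. }
  unfold continuous in Hc. rewrite Ropp_0, exp_0 in Hc.
  refine (filterlim_filter_le_1 _ _ Hc). apply filter_le_within.
- apply filterlim_locally; intros [e He].
  exists (Rmax 1 (/ e)). intros t Ht.
  assert (H1 : 1 < t) by (apply Rle_lt_trans with (2 := Ht); apply Rmax_l).
  assert (H2 : / e < t) by (apply Rle_lt_trans with (2 := Ht); apply Rmax_r).
  change (Rabs (- exp (- t) - 0) < e).
  rewrite Rminus_0_r, Rabs_Ropp, Rabs_pos_eq by (left; apply exp_pos).
  rewrite exp_Ropp, <- (Rinv_inv e).
  pose proof (exp_ineq1_le t). pose proof (Rinv_0_lt_compat e He).
  apply Rinv_lt_contravar; [apply Rmult_lt_0_compat|]; lra.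
Qed.

(** * The Beta integral *)

(** The truncation has to be explicit: [ln] is 0 on nonpositive reals, so [Rpower y p] is 1
    there. *)
Definition pospow (y p : R) : R := if Rlt_dec 0 y then Rpower y p else 0.

Lemma pospow_pos (y p : R) : 0 < y -> pospow y p = Rpower y p.
Proof. unfold pospow. destruct (Rlt_dec 0 y); lra. Qed.

Lemma pospow_neg (y p : R) : y <= 0 -> pospow y p = 0.
Proof. unfold pospow. destruct (Rlt_dec 0 y); lra. Qed.

Lemma pospow_ge0 (y p : R) : 0 <= pospow y p.
Proof. unfold pospow. destruct (Rlt_dec 0 y); [left; apply Rpower_pos|lra]. Qed.

Lemma pospow_succ (y p : R) : pospow y (p + 1) = y * pospow y p.
Proof.
unfold pospow. destruct (Rlt_dec 0 y); [|ring].
rewrite Rpower_plus, Rpower_1 by auto. ring.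
Qed.

Lemma pospow_le1 (y p : R) : y <= 1 -> 0 <= p -> pospow y p <= 1.
Proof.
intros Hy Hp. unfold pospow. destruct (Rlt_dec 0 y) as [H|]; [|lra].
unfold Rpower. rewrite <- exp_0. apply exp_le.
pose proof (ln_le_sub1 y H). nra.
Qed.

(** The delicate point is the cutoff [y = 0], where the difference quotient is [pospow h (p - 1)],
    at most [h] for small positive [h] because [p >= 2]. For the Beta weight, of exponent [c - 1],
    this becomes the condition [3 <= c]. *)
Lemma is_derive_pospow (p y : R) : 2 <= p ->
  is_derive (fun y => pospow y p) y (p * pospow y (p - 1)).
Proof.
intros Hp.
destruct (Rtotal_order y 0) as [Hy|[Hy|Hy]].
- rewrite (pospow_neg y (p - 1)) by lra. rewrite Rmult_0_r.
  apply (is_derive_ext_loc (fun _ => 0)).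
  + assert (Hq : 0 < - y) by lra. exists (mkposreal _ Hq). intros z Hz.
    change (Rabs (z - y) < - y) in Hz. apply Rabs_def2 in Hz.
    symmetry; apply pospow_neg; lra.
  + apply (is_derive_const (V := R_NormedModule)).
- subst y. rewrite (pospow_neg 0 (p - 1)) by lra. rewrite Rmult_0_r.
  apply is_derive_Reals. intros e He.
  assert (Hm : 0 < Rmin 1 e) by (apply Rmin_glb_lt; lra).
  exists (mkposreal _ Hm). intros h Hh Hlt. simpl in Hlt.
  rewrite Rplus_0_l, (pospow_neg 0 p) by lra.
  assert (L1 := Rmin_l 1 e). assert (L2 := Rmin_r 1 e).
  replace ((pospow h p - 0) / h - 0) with (pospow h (p - 1)).
  2:{ replace p with (p - 1 + 1) at 2 by ring. rewrite pospow_succ. field; auto. }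
  rewrite Rabs_pos_eq by apply pospow_ge0.
  replace (p - 1) with (p - 2 + 1) by ring. rewrite pospow_succ.
  destruct (Rle_lt_dec h 0) as [H0|H0].
  { rewrite pospow_neg; lra. }
  rewrite Rabs_pos_eq in Hlt by lra.
  assert (pospow h (p - 2) <= 1) by (apply pospow_le1; lra).
  assert (0 <= pospow h (p - 2)) by apply pospow_ge0.
  nra.
- rewrite pospow_pos by auto.
  apply (is_derive_ext_loc (fun y => Rpower y p)).
  + exists (mkposreal _ Hy). intros z Hz.
    change (Rabs (z - y) < y) in Hz. apply Rabs_def2 in Hz.
    symmetry; apply pospow_pos; lra.
  + apply is_derive_Rpower; auto.
Qed.

(* The weight of the Beta integral B(x, c) = int_0^1 u^(x-1) (1-u)^(c-1) du after u = e s, extended by 0 to (0, oo). *)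
Definition beta_weight (e c : R) (s : R) : R := pospow (1 - e * s) (c - 1).

Lemma is_derive_beta_weight (e c s : R) : 3 <= c ->
  is_derive (beta_weight e c) s (- e * ((c - 1) * beta_weight e (c - 1) s)).
Proof.
intros Hc. unfold beta_weight.
apply (is_derive_comp (fun y => pospow y (c - 1)) (fun s => 1 - e * s)).
- apply is_derive_pospow; lra.
- auto_derive; auto. ring.
Qed.

Lemma continuous_beta_weight (e c s : R) : 3 <= c ->
  continuous (beta_weight e c) s.
Proof.
intros Hc. apply (ex_derive_continuous (V := R_NormedModule)).
eexists. apply is_derive_beta_weight; auto.
Qed.

Lemma beta_weight_ge0 (e c s : R) : 0 <= beta_weight e c s.
Proof. apply pospow_ge0. Qed.

Lemma beta_weight_succ (e c s : R) :
  beta_weight e (c + 1) s = (1 - e * s) * beta_weight e c s.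
Proof.
unfold beta_weight. rewrite <- pospow_succ. f_equal; ring.
Qed.

(** On the support [t <= / e] the right side is at least 1. The constant blows up as [e] tends to 0:
    this gives convergence and boundary terms at fixed [e], not the uniform estimate. *)
Lemma beta_weight_bound (e c t : R) : 0 < e -> 1 <= c -> 0 < t ->
  Rabs (beta_weight e c t) <= exp (/ e) * exp (- t).
Proof.
intros He Hc Ht. rewrite Rabs_pos_eq by apply beta_weight_ge0.
rewrite <- exp_plus. unfold beta_weight.
destruct (Rle_lt_dec t (/ e)) as [H|H].
- apply Rle_trans with 1.
  + apply pospow_le1; nra.
  + rewrite <- exp_0. apply exp_le. lra.
- rewrite pospow_neg. left; apply exp_pos.
  apply Rmult_lt_compat_l with (r := e) in H; auto.
  rewrite Rinv_r in H; lra.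
Qed.

Lemma beta_weight_gt0 (e c s : R) : 0 < e <= 1 -> 0 < s < 1 -> 0 < beta_weight e c s.
Proof.
intros He Hs. unfold beta_weight. rewrite pospow_pos by nra. apply Rpower_pos.
Qed.

Lemma beta_moment_exists (e c x : R) : 0 < e -> 3 <= c -> 0 < x ->
  exists m, is_moment (beta_weight e c) x m.
Proof.
intros He Hc Hx. apply (is_moment_exists _ (exp (/ e))); auto.
- intros; apply continuous_beta_weight; auto.
- intros; apply beta_weight_bound; lra.
Qed.

Lemma beta_moment_pos (e c x m : R) : 0 < e <= 1 -> 3 <= c ->
  is_moment (beta_weight e c) x m -> 0 < m.
Proof.
intros He Hc. apply is_moment_pos.
- intros; apply beta_weight_ge0.
- intros; apply beta_weight_gt0; auto.
- intros; apply continuous_beta_weight; auto.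
Qed.

(** Integration by parts is applied to the weight of parameter [c + 1], whose derivative is a
    multiple of the weight of parameter [c]. Since the former is [1 - e t] times the latter, the
    outcome is [x * (m - e * m') = e * c * m']. *)
Lemma beta_moment_succ (e c x m m' : R) : 0 < e -> 3 <= c -> 0 < x ->
  is_moment (beta_weight e c) x m -> is_moment (beta_weight e c) (x + 1) m' ->
  m' = x / (e * (x + c)) * m.
Proof.
intros He Hc Hx Hm Hm'.
assert (H : is_pint (fun t => x * Rpower t (x - 1) * beta_weight e (c + 1) t
    + Rpower t x * (- e * (c * beta_weight e c t))) 0).
{ apply (moment_by_parts _ _ (exp (/ e))); auto.
  - intros t Ht. pose proof (is_derive_beta_weight e (c + 1) t ltac:(lra)) as D.
    replace (c + 1 - 1) with c in D by ring. exact D.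
  - intros t Ht.
    apply (continuous_scal_r (K := R_AbsRing) (V := R_NormedModule) (- e) (fun t => c * beta_weight e c t)).
    apply (continuous_scal_r (K := R_AbsRing) (V := R_NormedModule) c (beta_weight e c)).
    apply continuous_beta_weight; auto.
  - intros t Ht. apply beta_weight_bound; lra. }
assert (H' := is_RInt_gen_minus _ _ _ _ (is_RInt_gen_scal _ x _ Hm)
  (is_RInt_gen_scal _ (e * (x + c)) _ Hm')).
assert (E : minus (scal x m) (scal (e * (x + c)) m') = 0).
{ apply (is_pint_unique (V := R_CompleteNormedModule) _ _ _ H').
  revert H. apply (is_pint_ext (V := R_NormedModule)). intros t Ht.
  unfold minus, plus, opp, scal; simpl; unfold mult; simpl.
  rewrite beta_weight_succ. replace (x + 1 - 1) with (x - 1 + 1) by ring.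
  replace (Rpower t x) with (Rpower t (x - 1 + 1)) by (f_equal; ring).
  rewrite Rpower_plus, Rpower_1 by auto. ring. }
unfold minus, plus, opp, scal in E; simpl in E; unfold mult in E; simpl in E.
apply Rmult_eq_reg_l with (e * (x + c)).
- replace (e * (x + c) * (x / (e * (x + c)) * m)) with (x * m) by (field; split; nra). lra.
- apply Rgt_not_eq, Rmult_lt_0_compat; lra.
Qed.

(** At [x = 1] the power of [t] disappears and the antiderivative is elementary; this value pins
    down the constant in [beta_moment_eq]. *)
Lemma beta_moment_1 (e c m : R) : 0 < e -> 3 <= c ->
  is_moment (beta_weight e c) 1 m -> m = / (c * e).
Proof.
intros He Hc Hm.
transitivity (0 - - / (c * e)); [|ring].
refine (is_pint_unique (V := R_CompleteNormedModule) _ _ _ Hm _).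
apply (is_pint_ext (V := R_NormedModule) (beta_weight e c)).
{ intros t Ht. replace (1 - 1) with 0 by ring. rewrite Rpower_O by auto.
  symmetry; apply Rmult_1_l. }
set (F := fun t => - / (c * e) * beta_weight e (c + 1) t).
assert (HD : forall t, is_derive F t (beta_weight e c t)).
{ intros t.
  replace (beta_weight e c t) with (- / (c * e) * (- e * (c * beta_weight e c t)))
    by (field; lra).
  apply (is_derive_scal (beta_weight e (c + 1)) t (- / (c * e))).
  pose proof (is_derive_beta_weight e (c + 1) t ltac:(lra)) as D.
  replace (c + 1 - 1) with c in D by ring. exact D. }
apply (is_pint_derive F).
- auto.
- intros; apply continuous_beta_weight; auto.
- assert (Hc0 : continuous F 0).
  { apply (ex_derive_continuous (V := R_NormedModule)). eexists; apply HD. }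
  assert (E : F 0 = - / (c * e)).
  { unfold F, beta_weight. rewrite Rmult_0_r, Rminus_0_r, pospow_pos by lra.
    unfold Rpower. rewrite ln_1, Rmult_0_r, exp_0; ring. }
  unfold continuous in Hc0. rewrite E in Hc0.
  intros P HP. destruct (Hc0 P HP) as [d Hd]. exists d. intros y Hy _. exact (Hd y Hy).
- apply filterlim_locally; intros [d Hd].
  exists (/ e). intros t Ht.
  change (Rabs (F t - 0) < d).
  unfold F, beta_weight. rewrite pospow_neg.
  + rewrite Rmult_0_r, Rminus_0_r, Rabs_R0; auto.
  + apply Rmult_lt_compat_l with (r := e) in Ht; auto.
    rewrite Rinv_r in Ht; lra.
Qed.

(* A Bohr-Mollerup argument: periodicity moves any comparison to infinity, where the factor 1 + 1/x disappears. *)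
Lemma periodic_slowly_varying_const (h : R -> R) :
  (forall x, 0 < x -> h (x + 1) = h x) ->
  (forall x t, 0 < x -> 0 <= t <= 1 -> h (x + t) <= h x * (1 + / x)) ->
  forall x, 0 < x -> h x = h 1.
Proof.
intros Hp Hs.
assert (Hn : forall n x, 0 < x -> h (x + INR n) = h x).
{ induction n as [|n IH]; intros x Hx.
  - simpl. rewrite Rplus_0_r; auto.
  - rewrite S_INR. replace (x + (INR n + 1)) with (x + INR n + 1) by ring.
    rewrite Hp; auto. pose proof (pos_INR n); lra. }
assert (Hle : forall x t, 0 < x -> 0 <= t <= 1 -> h (x + t) <= h x).
{ intros x t Hx Ht. destruct (Rle_lt_dec (h (x + t)) (h x)) as [|Hlt]; auto. exfalso.
  set (d := h (x + t) - h x). assert (Hd : 0 < d) by (unfold d; lra).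
  destruct (INR_unbounded (Rabs (h x) / d)) as [n Hnn].
  pose proof (pos_INR n) as P.
  assert (H := Hs (x + INR n) t ltac:(lra) Ht).
  replace (x + INR n + t) with (x + t + INR n) in H by ring.
  rewrite (Hn n (x + t)), (Hn n x) in H by lra.
  assert (H1 : d <= Rabs (h x) / (x + INR n)).
  { unfold d. pose proof (Rle_abs (h x)).
    assert (0 < / (x + INR n)) by (apply Rinv_0_lt_compat; lra).
    unfold Rdiv. nra. }
  apply Rmult_le_compat_r with (r := x + INR n) in H1; [|lra].
  unfold Rdiv in H1. rewrite Rmult_assoc, Rinv_l in H1 by lra.
  apply Rmult_gt_compat_l with (r := d) in Hnn; auto.
  replace (d * (Rabs (h x) / d)) with (Rabs (h x)) in Hnn by (field; lra).
  nra. }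
(* A full period closes the chain [h x = h (x + 1) <= h (x + t) <= h x]. *)
assert (He : forall x t, 0 < x -> 0 <= t <= 1 -> h (x + t) = h x).
{ intros x t Hx Ht. apply Rle_antisym; auto.
  rewrite <- (Hp x Hx). replace (x + 1) with (x + t + (1 - t)) by ring.
  apply Hle; lra. }
assert (Hk : forall n x, 0 < x <= INR n + 1 -> h x = h 1).
{ induction n as [|n IH]; intros x Hx.
  - simpl in Hx. replace 1 with (x + (1 - x)) by ring. rewrite He; lra.
  - rewrite S_INR in Hx. destruct (Rle_lt_dec x 1).
    + replace 1 with (x + (1 - x)) by ring. rewrite He; lra.
    + replace x with (x - 1 + 1) by ring. rewrite Hp by lra. apply IH; lra. }
intros x Hx. destruct (INR_unbounded x) as [n Hnn].
apply (Hk n). lra.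
Qed.

Lemma Gamma_log_convex (x t : R) : 0 < x -> 0 <= t <= 1 ->
  Gamma (x + t) <= Rpower x t * Gamma x.
Proof.
intros Hx Ht.
replace (Rpower x t) with (Rpower (Gamma (x + 1) / Gamma x) t).
2:{ f_equal. rewrite Gamma_succ by auto. field. apply Rgt_not_eq, Gamma_pos; auto. }
apply (moment_log_convex (fun t => exp (- t)) x t (Gamma x) (Gamma (x + 1))); auto.
- intros; left; apply exp_pos.
- apply Gamma_pos; auto.
- apply Gamma_pos; lra.
- exact (Gamma_correct x Hx).
- exact (Gamma_correct (x + 1) ltac:(lra)).
- exact (Gamma_correct (x + t) ltac:(lra)).
Qed.

Lemma Rpower_le_self (y t : R) : 1 <= y -> 0 <= t <= 1 -> Rpower y t <= y.
Proof.
intros Hy Ht. rewrite <- (Rpower_1 y) at 2 by lra.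
apply Rle_Rpower; lra.
Qed.

Lemma Rpower_div_distr (y z t : R) : 0 < y -> 0 < z ->
  Rpower (y / z) t = Rpower y t / Rpower z t.
Proof.
intros Hy Hz. unfold Rpower. rewrite ln_div by auto.
unfold Rdiv. rewrite <- exp_Ropp, <- exp_plus. f_equal; ring.
Qed.

(** The function [h] is [Gamma c] times the ratio of the moment to its expected value. The
    functional equations make it 1-periodic, log-convexity makes it slowly varying, so it is
    constant, and its value at 1 is [Gamma c]. *)
Lemma beta_moment_eq (e c x m : R) : 0 < e <= 1 -> 3 <= c -> 0 < x ->
  is_moment (beta_weight e c) x m ->
  m = Rpower e (- x) * (Gamma x * Gamma c / Gamma (x + c)).
Proof.
intros He Hc.
set (M := (fun x => RInt_gen (fun t => Rpower t (x - 1) * beta_weight e c t)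
   (at_right 0) (Rbar_locally p_infty)) : R -> R).
assert (HM : forall x, 0 < x -> is_moment (beta_weight e c) x (M x)).
{ intros y Hy. destruct (beta_moment_exists e c y) as [m' Hm']; try lra.
  exact (RInt_gen_correct (V := R_CompleteNormedModule) (fun t => Rpower t (y - 1) * beta_weight e c t) (ex_intro _ m' Hm')). }
assert (HMp : forall x, 0 < x -> 0 < M x).
{ intros y Hy. apply (beta_moment_pos e c y); auto. }
assert (HMs : forall x, 0 < x -> M (x + 1) = x / (e * (x + c)) * M x).
{ intros y Hy. apply (beta_moment_succ e c y); auto; try lra. apply HM; lra. }
set (h := fun x => Rpower e x * M x * Gamma (x + c) / Gamma x).
assert (Hh : forall x, 0 < x -> h x = h 1).
{ apply periodic_slowly_varying_const.
  - intros y Hy. unfold h. rewrite HMs by auto.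
    replace (y + 1 + c) with (y + c + 1) by ring.
    rewrite !Gamma_succ, Rpower_plus, Rpower_1 by lra.
    assert (0 < Gamma y) by (apply Gamma_pos; auto). field. lra.
  - intros y t Hy Ht. unfold h.
    assert (G0 : 0 < Gamma y) by (apply Gamma_pos; auto).
    assert (G1 : 0 < Gamma (y + t)) by (apply Gamma_pos; lra).
    assert (G2 : 0 < Gamma (y + c)) by (apply Gamma_pos; lra).
    assert (E1 : M (y + t) <= Rpower (y / (e * (y + c))) t * M y).
    { replace (y / (e * (y + c))) with (M (y + 1) / M y).
      2:{ rewrite HMs by auto. field. specialize (HMp y Hy). lra. }
      apply (moment_log_convex (beta_weight e c) y t (M y) (M (y + 1))); auto.
      - intros; apply beta_weight_ge0.
      - apply HMp; lra.
      - apply HM; lra.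
      - apply HM; lra. }
    assert (E2 : Gamma (y + c + t) <= Rpower (y + c) t * Gamma (y + c)).
    { apply Gamma_log_convex; lra. }
    (* [Gamma (y + t)] stands in the denominator of [h] and needs a lower bound: log-convexity is
       used from [y + t] up to [y + 1]. *)
    assert (E3 : y * Gamma y <= Rpower (y + t) (1 - t) * Gamma (y + t)).
    { rewrite <- Gamma_succ by auto. replace (y + 1) with (y + t + (1 - t)) by ring.
      apply Gamma_log_convex; lra. }
    replace (y + t + c) with (y + c + t) by ring.
    rewrite Rpower_plus.
    assert (Hye : 0 < e * (y + c)) by nra.
    rewrite Rpower_div_distr in E1 by auto.
    rewrite <- Rpower_mult_distr in E1 by lra.
    pose proof (Rpower_pos e t). pose proof (Rpower_pos e y).
    pose proof (Rpower_pos (y + c) t). pose proof (Rpower_pos y t).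
    assert (P0 := HMp y Hy). assert (P1 : 0 < M (y + t)) by (apply HMp; lra).
    assert (P2 : 0 < Gamma (y + c + t)) by (apply Gamma_pos; lra).
    assert (E4 : M (y + t) * Gamma (y + c + t) <=
       Rpower y t / Rpower e t * (M y * Gamma (y + c))).
    { apply Rle_trans with (Rpower y t / (Rpower e t * Rpower (y + c) t) * M y
         * (Rpower (y + c) t * Gamma (y + c))).
      - apply Rmult_le_compat; lra.
      - right; field. lra. }
    assert (E5 : / Gamma (y + t) <= Rpower (y + t) (1 - t) / (y * Gamma y)).
    { apply Rmult_le_reg_r with (Gamma (y + t) * (y * Gamma y)).
      - apply Rmult_lt_0_compat; auto; nra.
      - replace (/ Gamma (y + t) * (Gamma (y + t) * (y * Gamma y))) with (y * Gamma y) by (field; lra).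
        replace (Rpower (y + t) (1 - t) / (y * Gamma y) * (Gamma (y + t) * (y * Gamma y)))
          with (Rpower (y + t) (1 - t) * Gamma (y + t)) by (field; lra). auto. }
    apply Rle_trans with (Rpower e y * Rpower e t *
      (Rpower y t / Rpower e t * (M y * Gamma (y + c))) * (Rpower (y + t) (1 - t) / (y * Gamma y))).
    { unfold Rdiv at 1. apply Rmult_le_compat; auto.
      - apply Rmult_le_pos; [|lra]. apply Rmult_le_pos; nra.
      - left; apply Rinv_0_lt_compat; auto.
      - rewrite Rmult_assoc. rewrite Rmult_assoc. rewrite Rmult_assoc.
        apply Rmult_le_compat_l; [lra|]. apply Rmult_le_compat_l; lra. }
    (* The powers of [e] and [y + c] have cancelled; what the upper and lower interpolations fail to
       cancel is [((y + t) / y)^(1 - t)], the source of the factor [1 + / y]. *)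
    assert (E6 : Rpower y t * Rpower (y + t) (1 - t) = y * Rpower ((y + t) / y) (1 - t)).
    { rewrite Rpower_div_distr by lra.
      replace y with (Rpower y (t + (1 - t))) at 3.
      2:{ replace (t + (1 - t)) with 1 by ring. apply Rpower_1; auto. }
      rewrite Rpower_plus. field. apply Rgt_not_eq, Rpower_pos. }
    assert (E7 : Rpower ((y + t) / y) (1 - t) <= 1 + / y).
    { apply Rle_trans with ((y + t) / y).
      - apply Rpower_le_self; [|lra].
        apply Rmult_le_reg_r with y; auto. unfold Rdiv; rewrite Rmult_assoc, Rinv_l; lra.
      - apply Rmult_le_reg_r with y; auto. unfold Rdiv; rewrite Rmult_assoc, Rinv_l by lra.
        rewrite Rmult_1_r, Rmult_plus_distr_r, Rinv_l; lra. }
    replace (Rpower e y * Rpower e t *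
      (Rpower y t / Rpower e t * (M y * Gamma (y + c))) * (Rpower (y + t) (1 - t) / (y * Gamma y)))
      with (Rpower e y * M y * Gamma (y + c) / Gamma y * ((Rpower y t * Rpower (y + t) (1 - t)) / y))
      by (field; lra).
    rewrite E6.
    replace (y * Rpower ((y + t) / y) (1 - t) / y) with (Rpower ((y + t) / y) (1 - t)) by (field; lra).
    apply Rmult_le_compat_l; auto.
    apply Rmult_le_pos; [|left; apply Rinv_0_lt_compat; auto].
    apply Rmult_le_pos; nra. }
intros Hx Hm.
assert (E : m = M x).
{ exact (is_pint_unique (V := R_CompleteNormedModule) _ _ _ Hm (HM x Hx)). }
assert (E1 : h x = Gamma c).
{ rewrite Hh by auto. unfold h.
  rewrite (beta_moment_1 e c (M 1)) by (try lra; apply HM; lra).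
  rewrite Gamma_1, Rpower_1 by lra. rewrite (Rplus_comm 1 c), Gamma_succ by lra. field; lra. }
unfold h in E1. change (@eq R m (Rpower e (- x) * (Gamma x * Gamma c / Gamma (x + c)))).
rewrite E, <- E1, Rpower_Ropp.
pose proof (Rpower_pos e x).
assert (0 < Gamma x) by (apply Gamma_pos; auto).
assert (0 < Gamma (x + c)) by (apply Gamma_pos; lra).
field. lra.
Qed.

Lemma poch_pos (x : R) (k : nat) : 0 < x -> 0 < poch x k.
Proof.
intros Hx. induction k as [|k IH]; simpl; [lra|].
pose proof (pos_INR k). apply Rmult_lt_0_compat; lra.
Qed.

(** These Pochhammer quotients are the ones in the coefficients of [hyp1F1 x (x + c)]; they let
    Euler's integral be recognized term by term. *)
Lemma beta_moment_poch (e c x m mk : R) (k : nat) : 0 < e <= 1 -> 3 <= c -> 0 < x ->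
  is_moment (beta_weight e c) x m -> is_moment (beta_weight e c) (x + INR k) mk ->
  mk = / e ^ k * (poch x k / poch (x + c) k) * m.
Proof.
intros He Hc Hx Hm. revert mk.
induction k as [|k IH]; intros mk Hk.
- simpl in Hk. rewrite Rplus_0_r in Hk.
  rewrite (is_pint_unique (V := R_CompleteNormedModule) _ _ _ Hk Hm). simpl; field.
- pose proof (pos_INR k) as P.
  destruct (beta_moment_exists e c (x + INR k)) as [m' Hm']; try lra.
  rewrite S_INR in Hk. replace (x + (INR k + 1)) with (x + INR k + 1) in Hk by ring.
  rewrite (beta_moment_succ e c (x + INR k) m' mk) by (auto; lra).
  rewrite (IH m' Hm'). simpl.
  assert (0 < poch (x + c) k) by (apply poch_pos; lra).
  assert (0 < e ^ k) by (apply pow_lt; lra).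
  field. repeat split; try lra.
Qed.

(** * Expansion of the Laplace kernel *)

Lemma nonneg_of_derive (f f' : R -> R) (u : R) : 0 <= u ->
  (forall t, 0 <= t <= u -> is_derive f t (f' t)) ->
  (forall t, 0 <= t <= u -> 0 <= f' t) -> f 0 = 0 -> 0 <= f u.
Proof.
intros Hu Hd Hp H0.
destruct (MVT_gen f 0 u f') as [c [Hc E]].
- intros x Hx. rewrite Rmin_left, Rmax_right in Hx by lra. apply Hd; lra.
- intros x Hx. rewrite Rmin_left, Rmax_right in Hx by lra.
  apply continuity_pt_filterlim, (ex_derive_continuous (V := R_NormedModule)).
  exists (f' x); apply Hd; lra.
- rewrite Rmin_left, Rmax_right in Hc by lra.
  assert (0 <= f' c) by (apply Hp; lra). rewrite H0 in E. nra.
Qed.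

Ltac nonneg_by_derive u g :=
  pattern u;
  match goal with |- (fun y => 0 <= @?f y) _ => apply (nonneg_of_derive f g u) end;
  cbv beta.

Lemma ln_one_minus_le (u : R) : 0 <= u < 1 -> ln (1 - u) <= - u - u ^ 2 / 2.
Proof.
intros Hu.
assert (0 <= (fun u => - u - u ^ 2 / 2 - ln (1 - u)) u); [|simpl in *; lra].
nonneg_by_derive u (fun t => t ^ 2 / (1 - t)); try lra.
- intros t Ht. auto_derive; [lra|]. field; lra.
- intros t Ht. apply Rmult_le_pos; [apply pow2_ge_0|].
  left; apply Rinv_0_lt_compat; lra.
- rewrite Rminus_0_r, ln_1. lra.
Qed.

(** The remainder has derivative [- t ^ 4 / (1 - t)], with [1 / (1 - t) <= 2] on this range. Order
    four is taken because the prefactor [/ e ^ 2] lowers the order by two: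
    [u ^ 5 / e ^ 2 = e ^ 3 * s ^ 5]. *)
Lemma ln_one_minus_taylor (u : R) : 0 <= u <= 1 / 2 ->
  Rabs (ln (1 - u) + u + u ^ 2 / 2 + u ^ 3 / 3 + u ^ 4 / 4) <= 2 * u ^ 5.
Proof.
intros Hu.
assert (H1 : 0 <= (fun u => - (ln (1 - u) + u + u ^ 2 / 2 + u ^ 3 / 3 + u ^ 4 / 4)) u).
{ nonneg_by_derive u (fun t => t ^ 4 / (1 - t)); try lra.
  - intros t Ht. auto_derive; [lra|]. field; lra.
  - intros t Ht. apply Rmult_le_pos; [apply pow_le; lra|].
    left; apply Rinv_0_lt_compat; lra.
  - rewrite Rminus_0_r, ln_1. lra. }
assert (H2 : 0 <= (fun u => 2 * u ^ 5 + (ln (1 - u) + u + u ^ 2 / 2 + u ^ 3 / 3 + u ^ 4 / 4)) u).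
{ nonneg_by_derive u (fun t => t ^ 4 * (10 - / (1 - t))); try lra.
  - intros t Ht. auto_derive; [lra|]. field; lra.
  - intros t Ht. apply Rmult_le_pos; [apply pow_le; lra|].
    assert (/ (1 - t) <= / (1 / 2)) by (apply Rinv_le_contravar; lra). lra.
  - rewrite Rminus_0_r, ln_1. lra. }
simpl in H1, H2. apply Rabs_le. simpl. lra.
Qed.

(** The remainder is at most [x ^ 3 * exp x] for [x >= 0] and [|x| ^ 3] for [x < 0]; [1 + exp x]
    covers both. This factor stays bounded when [x] is only bounded above, which is the uniform
    control available for the exponent of the kernel. *)
Lemma exp_taylor2 (x : R) :
  Rabs (exp x - 1 - x - x ^ 2 / 2) <= Rabs x ^ 3 * (1 + exp x).
Proof.
destruct (Rle_lt_dec 0 x) as [Hx|Hx].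
- assert (I1 : forall t, 0 <= t -> exp t - 1 <= t * exp t).
  { intros t Ht. pose proof (exp_ineq1_le (- t)). rewrite exp_Ropp in H.
    pose proof (exp_pos t).
    apply Rmult_le_compat_r with (r := exp t) in H; [|lra].
    rewrite Rinv_l in H; lra. }
  assert (I2 : forall t, 0 <= t -> exp t - 1 - t <= t ^ 2 * exp t).
  { intros t Ht.
    assert (0 <= (fun t => t ^ 2 * exp t - (exp t - 1 - t)) t); [|simpl in *; lra].
    nonneg_by_derive t (fun t => 2 * t * exp t + t ^ 2 * exp t - (exp t - 1)); auto.
    - intros s Hs. auto_derive; auto. ring.
    - intros s Hs. specialize (I1 s (proj1 Hs)). pose proof (exp_pos s).
      assert (0 <= s ^ 2) by apply pow2_ge_0. nra.
    - rewrite exp_0; ring. }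
  assert (H1 : 0 <= (fun t => exp t - 1 - t - t ^ 2 / 2) x).
  { nonneg_by_derive x (fun t => exp t - 1 - t); auto.
    - intros s Hs. auto_derive; auto. field.
    - intros s Hs. pose proof (exp_ineq1_le s). lra.
    - rewrite exp_0; field. }
  assert (H2 : 0 <= (fun t => t ^ 3 * exp t - (exp t - 1 - t - t ^ 2 / 2)) x).
  { nonneg_by_derive x (fun t => 3 * t ^ 2 * exp t + t ^ 3 * exp t - (exp t - 1 - t)); auto.
    - intros s Hs. auto_derive; auto. field.
    - intros s Hs. specialize (I2 s (proj1 Hs)). pose proof (exp_pos s).
      assert (0 <= s ^ 2) by apply pow2_ge_0. assert (0 <= s ^ 3) by (apply pow_le; lra). nra.
    - rewrite exp_0; field. }
  simpl in H1, H2. rewrite !Rabs_pos_eq; simpl; auto.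
  assert (0 <= x ^ 3) by (apply pow_le; lra). simpl in *. nra.
- assert (H1 : 0 <= (fun t => - (exp (- t) - 1 + t - t ^ 2 / 2)) (- x)).
  { nonneg_by_derive (- x) (fun t => exp (- t) - 1 + t); try lra.
    - intros s Hs. auto_derive; auto. field.
    - intros s Hs. pose proof (exp_ineq1_le (- s)). lra.
    - rewrite Ropp_0, exp_0; field. }
  assert (H2 : 0 <= (fun t => t ^ 3 + (exp (- t) - 1 + t - t ^ 2 / 2)) (- x)).
  { nonneg_by_derive (- x) (fun t => 3 * t ^ 2 + (1 - exp (- t) - t)); try lra.
    - intros s Hs. auto_derive; auto. field.
    - intros s Hs. assert (exp (- s) <= 1 - s + s ^ 2); [|pose proof (pow2_ge_0 s); lra].
      rewrite exp_Ropp. pose proof (exp_ineq1_le s) as I.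
      apply Rle_trans with (/ (1 + s)); [apply Rinv_le_contravar; lra|].
      apply Rmult_le_reg_r with (1 + s); [lra|]. rewrite Rinv_l by lra.
      assert (0 <= s ^ 3) by (apply pow_le; lra). simpl in *. lra.
    - rewrite Ropp_0, exp_0; field. }
  cbv beta in H1, H2. rewrite Ropp_involutive in H1, H2.
  rewrite (Rabs_left x), Rabs_left1; try lra.
  assert (0 <= (- x) ^ 3) by (apply pow_le; lra). pose proof (exp_pos x).
  assert (0 <= (- x) ^ 3 * exp x) by (apply Rmult_le_pos; lra).
  replace (x ^ 2) with ((- x) ^ 2) by ring. lra.
Qed.

(* First two coefficients in e of the exponent (e^-2 - A) ln(1 - e s) + s / e + s^2 / 2. *)
Definition lap1 (A s : R) : R := A * s - s ^ 3 / 3.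
Definition lap2 (A s : R) : R := A * s ^ 2 / 2 - s ^ 4 / 4.

Lemma lap1_bound (A s : R) : 0 <= A -> 0 < s -> Rabs (lap1 A s) <= (A + 1) * (1 + s) ^ 3.
Proof.
intros HA Hs. unfold lap1.
assert (0 <= s ^ 3) by (apply pow_le; lra).
assert (0 <= A * s) by (apply Rmult_le_pos; lra).
assert (A * s <= A * (1 + s) ^ 3).
{ apply Rmult_le_compat_l; auto. simpl; nra. }
assert (s ^ 3 <= (1 + s) ^ 3) by (apply pow_incr; lra).
apply Rabs_le. lra.
Qed.

Lemma lap2_bound (A s : R) : 0 <= A -> 0 < s -> Rabs (lap2 A s) <= (A + 1) * (1 + s) ^ 4.
Proof.
intros HA Hs. unfold lap2.
assert (0 <= s ^ 4) by (apply pow_le; lra).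
assert (0 <= s ^ 2) by (apply pow_le; lra).
assert (0 <= A * s ^ 2) by (apply Rmult_le_pos; lra).
assert (s ^ 2 <= (1 + s) ^ 4).
{ replace ((1 + s) ^ 4) with (s ^ 2 + (1 + 4 * s + 5 * s ^ 2 + 4 * s ^ 3 + s ^ 4)) by ring.
  assert (0 <= s ^ 3) by (apply pow_le; lra). lra. }
assert (A * s ^ 2 <= A * (1 + s) ^ 4) by (apply Rmult_le_compat_l; auto).
assert (s ^ 4 <= (1 + s) ^ 4) by (apply pow_incr; lra).
apply Rabs_le. lra.
Qed.

(** With [A = a + 1], the factor [/ e ^ 2 - A] is the exponent [b - a - 1] of Euler's integral. In
    [u = e s] everything up to order [e ^ 2] cancels, leaving [A * (u ^ 3 / 3 + u ^ 4 / 4)] and the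
    logarithmic remainder [phi] times that factor. *)
Lemma lap_exponent (A e s : R) : 0 < A -> 0 < e <= 1 -> A <= / e ^ 2 -> 0 < s -> e * s <= 1 / 2 ->
  Rabs (s / e + (/ e ^ 2 - A) * ln (1 - e * s) + s ^ 2 / 2 - e * lap1 A s - e ^ 2 * lap2 A s)
  <= 2 * (A + 1) * (e ^ 3 * (1 + s) ^ 5).
Proof.
intros HA He Hb Hs Hes.
set (u := e * s). assert (Hu : 0 < u) by (unfold u; nra).
assert (HT := ln_one_minus_taylor u ltac:(unfold u in *; lra)).
set (phi := ln (1 - u) + u + u ^ 2 / 2 + u ^ 3 / 3 + u ^ 4 / 4) in *.
replace (ln (1 - u)) with (phi - u - u ^ 2 / 2 - u ^ 3 / 3 - u ^ 4 / 4) by (unfold phi; ring).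
replace (s / e + (/ e ^ 2 - A) * (phi - u - u ^ 2 / 2 - u ^ 3 / 3 - u ^ 4 / 4) + s ^ 2 / 2
   - e * lap1 A s - e ^ 2 * lap2 A s)
  with (A * (u ^ 3 / 3 + u ^ 4 / 4) + (/ e ^ 2 - A) * phi).
2:{ unfold lap1, lap2, u. field. lra. }
eapply Rle_trans; [apply Rabs_triang|].
assert (U3 : 0 < u ^ 3) by (apply pow_lt; auto).
assert (U4 : 0 < u ^ 4 <= u ^ 3 * (1 / 2)).
{ split; [apply pow_lt; auto|]. replace (u ^ 4) with (u ^ 3 * u) by ring.
  apply Rmult_le_compat_l; [lra|auto]. }
rewrite (Rabs_pos_eq (A * _)) by (apply Rmult_le_pos; lra).
rewrite Rabs_mult, (Rabs_pos_eq (/ e ^ 2 - A)) by lra.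
assert (T1 : (/ e ^ 2 - A) * Rabs phi <= / e ^ 2 * (2 * u ^ 5)).
{ apply Rmult_le_compat; try lra. apply Rabs_pos. }
replace (/ e ^ 2 * (2 * u ^ 5)) with (2 * (e ^ 3 * s ^ 5)) in T1 by (unfold u; field; lra).
assert (T2 : A * (u ^ 3 / 3 + u ^ 4 / 4) <= A * (e ^ 3 * s ^ 3)).
{ replace (e ^ 3 * s ^ 3) with (u ^ 3) by (unfold u; ring). apply Rmult_le_compat_l; lra. }
assert (E3 : 0 < e ^ 3) by (apply pow_lt; lra).
assert (S5 : s ^ 5 <= (1 + s) ^ 5) by (apply pow_incr; lra).
assert (S3 : s ^ 3 <= (1 + s) ^ 5).
{ apply Rle_trans with ((1 + s) ^ 3); [apply pow_incr; lra|apply Rle_pow; [lra|lia]]. }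
assert (e ^ 3 * s ^ 5 <= e ^ 3 * (1 + s) ^ 5) by (apply Rmult_le_compat_l; lra).
assert (e ^ 3 * s ^ 3 <= e ^ 3 * (1 + s) ^ 5) by (apply Rmult_le_compat_l; lra).
assert (0 < e ^ 3 * s ^ 3) by (apply Rmult_lt_0_compat; auto; apply pow_lt; auto).
assert (A * (e ^ 3 * s ^ 3) <= A * (e ^ 3 * (1 + s) ^ 5)) by (apply Rmult_le_compat_l; lra).
assert (0 <= A * (e ^ 3 * (1 + s) ^ 5)) by (apply Rmult_le_pos; lra).
lra.
Qed.

(** With [p = lap1 A s] and [q = lap2 A s], the difference is the cubic remainder of [exp d], plus
    [d - e p - e^2 q], plus [(d - e p) * (d + e p) / 2]. The inequality [e * M <= 3 / 2] trades an
    excess power of [M] against one of [e]: it gives [4 = 3 + 1] for [d - e p], [7 = 4 * 3 / 2 + 1]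
    for [d] and 8 for [d + e p]; hence [343 = 7 ^ 3] and [16 = 4 * 8 / 2]. *)
Lemma lap_factor_near (A e s : R) : 0 < A -> 0 < e <= 1 -> A <= / e ^ 2 -> 0 < s -> e * s <= 1 / 2 ->
  let d := s / e + (/ e ^ 2 - A) * ln (1 - e * s) + s ^ 2 / 2 in
  Rabs (exp d - (1 + e * lap1 A s + e ^ 2 * (lap2 A s + lap1 A s ^ 2 / 2)))
  <= (343 * (A + 1) ^ 3 * (1 + exp d) + 2 * (A + 1) + 16 * (A + 1) ^ 2) * (e ^ 3 * (1 + s) ^ 9).
Proof.
intros HA He Hb Hs Hes d.
assert (HR := lap_exponent A e s HA He Hb Hs Hes). fold d in HR.
assert (L1 := lap1_bound A s ltac:(lra) Hs).
assert (L2 := lap2_bound A s ltac:(lra) Hs).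
set (p := lap1 A s) in *. set (q := lap2 A s) in *. set (B := A + 1) in *. set (M := 1 + s) in *.
assert (HB : 1 < B) by (unfold B; lra). assert (HM : 1 < M) by (unfold M; lra).
assert (HeM : e * M <= 3 / 2) by (unfold M; lra).
assert (E2 : 0 < e ^ 2) by (apply pow_lt; lra).
assert (E3 : 0 < e ^ 3) by (apply pow_lt; lra).
assert (M3 : 0 < M ^ 3) by (apply pow_lt; lra).
assert (M4 : 0 < M ^ 4) by (apply pow_lt; lra).
assert (P1 : Rabs (e * p) <= e * (B * M ^ 3)).
{ rewrite Rabs_mult, Rabs_pos_eq by lra. apply Rmult_le_compat_l; lra. }
assert (P2 : Rabs (e ^ 2 * q) <= e ^ 2 * (B * M ^ 4)).
{ rewrite Rabs_mult, (Rabs_pos_eq (e ^ 2)) by lra. apply Rmult_le_compat_l; lra. }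
assert (P3 : Rabs (d - e * p) <= 4 * (e ^ 2 * (B * M ^ 4))).
{ replace (d - e * p) with (d - e * p - e ^ 2 * q + e ^ 2 * q) by ring.
  eapply Rle_trans; [apply Rabs_triang|].
  assert (2 * B * (e ^ 3 * M ^ 5) <= 3 * (e ^ 2 * (B * M ^ 4))); [|lra].
  replace (2 * B * (e ^ 3 * M ^ 5)) with (2 * (e ^ 2 * (B * M ^ 4)) * (e * M)) by ring.
  replace (3 * (e ^ 2 * (B * M ^ 4))) with (2 * (e ^ 2 * (B * M ^ 4)) * (3 / 2)) by field.
  apply Rmult_le_compat_l; auto. apply Rmult_le_pos; [lra|]. apply Rmult_le_pos; [lra|].
  apply Rmult_le_pos; lra. }
assert (P4 : e ^ 2 * (B * M ^ 4) <= 3 / 2 * (e * (B * M ^ 3))).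
{ replace (e ^ 2 * (B * M ^ 4)) with (e * M * (e * (B * M ^ 3))) by ring.
  apply Rmult_le_compat_r; auto. apply Rmult_le_pos; [lra|]. apply Rmult_le_pos; lra. }
assert (P5 : Rabs d <= 7 * (e * (B * M ^ 3))).
{ replace d with (d - e * p + e * p) by ring.
  eapply Rle_trans; [apply Rabs_triang|]. lra. }
assert (P6 : Rabs (d + e * p) <= 8 * (e * (B * M ^ 3))).
{ eapply Rle_trans; [apply Rabs_triang|]. lra. }
assert (Q1 : Rabs d ^ 3 * (1 + exp d) <= 343 * B ^ 3 * (1 + exp d) * (e ^ 3 * M ^ 9)).
{ pose proof (exp_pos d).
  replace (343 * B ^ 3 * (1 + exp d) * (e ^ 3 * M ^ 9)) with ((7 * (e * (B * M ^ 3))) ^ 3 * (1 + exp d)) by ring.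
  apply Rmult_le_compat_r; [lra|]. apply pow_incr. split; auto. apply Rabs_pos. }
assert (Q2 : 2 * B * (e ^ 3 * M ^ 5) <= 2 * B * (e ^ 3 * M ^ 9)).
{ apply Rmult_le_compat_l; [lra|]. apply Rmult_le_compat_l; [lra|]. apply Rle_pow; [lra|lia]. }
assert (Q3 : Rabs ((d - e * p) * (d + e * p)) <= 32 * B ^ 2 * (e ^ 3 * M ^ 9)).
{ rewrite Rabs_mult.
  apply Rle_trans with (4 * (e ^ 2 * (B * M ^ 4)) * (8 * (e * (B * M ^ 3)))).
  - apply Rmult_le_compat; auto; apply Rabs_pos.
  - replace (4 * (e ^ 2 * (B * M ^ 4)) * (8 * (e * (B * M ^ 3)))) with (32 * B ^ 2 * (e ^ 3 * M ^ 7)) by ring.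
    apply Rmult_le_compat_l. assert (0 <= B ^ 2) by apply pow2_ge_0; lra.
    apply Rmult_le_compat_l; [lra|]. apply Rle_pow; [lra|lia]. }
replace (exp d - (1 + e * p + e ^ 2 * (q + p ^ 2 / 2)))
  with ((exp d - 1 - d - d ^ 2 / 2) + (d - e * p - e ^ 2 * q) + (d - e * p) * (d + e * p) * / 2) by field.
eapply Rle_trans; [apply Rabs_triang|].
eapply Rle_trans; [apply Rplus_le_compat_r, Rabs_triang|].
assert (Q4 := exp_taylor2 d).
rewrite (Rabs_mult _ (/ 2)), (Rabs_pos_eq (/ 2)) by lra.
lra.
Qed.

(** No cancellation is used: since [1 <= 2 * (e * M)], each term separately is multiplied by the
    power of [2 * (e * M)] that brings it to order [e ^ 3]. Leaving [g] arbitrary covers both the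
    kernel inside its support and the value 0 outside. *)
Lemma lap_factor_far (A e s g : R) : 0 < A -> 0 < e <= 1 -> 0 < s -> 1 / 2 <= e * s ->
  Rabs (g - (1 + e * lap1 A s + e ^ 2 * (lap2 A s + lap1 A s ^ 2 / 2)))
  <= (8 * Rabs g + 8 + 6 * (A + 1) + (A + 1) ^ 2) * (e ^ 3 * (1 + s) ^ 9).
Proof.
intros HA He Hs Hes.
assert (L1 := lap1_bound A s ltac:(lra) Hs).
assert (L2 := lap2_bound A s ltac:(lra) Hs).
set (p := lap1 A s) in *. set (q := lap2 A s) in *. set (B := A + 1) in *. set (M := 1 + s) in *.
assert (HB : 1 < B) by (unfold B; lra). assert (HM : 1 < M) by (unfold M; lra).
assert (HeM : 1 <= 2 * (e * M)) by (unfold M; lra).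
assert (E1 : 0 < e) by lra.
assert (E2 : 0 < e ^ 2) by (apply pow_lt; lra).
assert (E3 : 0 < e ^ 3) by (apply pow_lt; lra).
assert (W0 : 1 <= (2 * (e * M)) ^ 2) by (apply pow_R1_Rle; auto).
assert (W1 : 1 <= (2 * (e * M)) ^ 3) by (apply pow_R1_Rle; auto).
assert (Mk : forall k, (k <= 9)%nat -> e ^ 3 * M ^ k <= e ^ 3 * M ^ 9).
{ intros k Hk. apply Rmult_le_compat_l; [lra|]. apply Rle_pow; [lra|auto]. }
assert (Pk : forall k, 0 < M ^ k) by (intros k; apply pow_lt; lra).
assert (T0 : 1 <= 8 * (e ^ 3 * M ^ 9)).
{ replace ((2 * (e * M)) ^ 3) with (8 * (e ^ 3 * M ^ 3)) in W1 by ring.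
  specialize (Mk 3%nat ltac:(lia)). lra. }
assert (T1 : Rabs g <= 8 * Rabs g * (e ^ 3 * M ^ 9)).
{ pose proof (Rabs_pos g). nra. }
assert (T2 : Rabs (e * p) <= 4 * B * (e ^ 3 * M ^ 9)).
{ rewrite Rabs_mult, Rabs_pos_eq by lra.
  apply Rle_trans with (e * (B * M ^ 3) * (2 * (e * M)) ^ 2).
  - apply Rle_trans with (e * (B * M ^ 3)); [apply Rmult_le_compat_l; lra|].
    rewrite <- (Rmult_1_r (e * (B * M ^ 3))) at 1. apply Rmult_le_compat_l; auto.
    specialize (Pk 3%nat). apply Rmult_le_pos; [lra|]. apply Rmult_le_pos; lra.
  - replace (e * (B * M ^ 3) * (2 * (e * M)) ^ 2) with (4 * B * (e ^ 3 * M ^ 5)) by ring.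
    apply Rmult_le_compat_l; [lra|]. apply Mk; lia. }
assert (T3 : Rabs (e ^ 2 * q) <= 2 * B * (e ^ 3 * M ^ 9)).
{ rewrite Rabs_mult, (Rabs_pos_eq (e ^ 2)) by lra.
  apply Rle_trans with (e ^ 2 * (B * M ^ 4) * (2 * (e * M))).
  - apply Rle_trans with (e ^ 2 * (B * M ^ 4)); [apply Rmult_le_compat_l; lra|].
    rewrite <- (Rmult_1_r (e ^ 2 * (B * M ^ 4))) at 1. apply Rmult_le_compat_l; auto.
    specialize (Pk 4%nat). apply Rmult_le_pos; [lra|]. apply Rmult_le_pos; lra.
  - replace (e ^ 2 * (B * M ^ 4) * (2 * (e * M))) with (2 * B * (e ^ 3 * M ^ 5)) by ring.
    apply Rmult_le_compat_l; [lra|]. apply Mk; lia. }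
assert (T4 : Rabs (e ^ 2 * (p ^ 2 / 2)) <= B ^ 2 * (e ^ 3 * M ^ 9)).
{ assert (H2 : p ^ 2 <= (B * M ^ 3) ^ 2).
  { rewrite <- (pow2_abs p). apply pow_incr. split; auto. apply Rabs_pos. }
  assert (H0 := pow2_ge_0 p).
  rewrite Rabs_pos_eq by (apply Rmult_le_pos; lra).
  apply Rle_trans with (e ^ 2 * ((B * M ^ 3) ^ 2 / 2) * (2 * (e * M))).
  - apply Rle_trans with (e ^ 2 * ((B * M ^ 3) ^ 2 / 2)); [apply Rmult_le_compat_l; lra|].
    rewrite <- (Rmult_1_r (e ^ 2 * ((B * M ^ 3) ^ 2 / 2))) at 1. apply Rmult_le_compat_l; auto.
    apply Rmult_le_pos; lra.
  - replace (e ^ 2 * ((B * M ^ 3) ^ 2 / 2) * (2 * (e * M))) with (B ^ 2 * (e ^ 3 * M ^ 7)) by field.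
    apply Rmult_le_compat_l; [apply pow2_ge_0|]. apply Mk; lia. }
replace (g - (1 + e * p + e ^ 2 * (q + p ^ 2 / 2)))
  with (g - 1 - e * p - e ^ 2 * q - e ^ 2 * (p ^ 2 / 2)) by ring.
unfold Rminus.
eapply Rle_trans; [apply Rabs_triang|]. rewrite Rabs_Ropp.
eapply Rle_trans; [apply Rplus_le_compat_r, Rabs_triang|]. rewrite Rabs_Ropp.
eapply Rle_trans; [apply Rplus_le_compat_r, Rplus_le_compat_r, Rabs_triang|]. rewrite Rabs_Ropp.
eapply Rle_trans; [apply Rplus_le_compat_r, Rplus_le_compat_r, Rplus_le_compat_r, Rabs_triang|].
rewrite (Rabs_left1 (- (1))) by lra. lra.
Qed.

Lemma laplace_kernel_expansion (a : R) : 0 < a ->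
  exists K, 0 < K /\ forall e s, 0 < e <= 1 -> a + 1 <= / e ^ 2 -> 0 < s ->
    Rabs (exp (s / e) * beta_weight e (/ e ^ 2 - a) s
      - exp (- (s ^ 2 / 2)) * (1 + e * lap1 (a + 1) s
          + e ^ 2 * (lap2 (a + 1) s + lap1 (a + 1) s ^ 2 / 2)))
    <= K * e ^ 3 * ((1 + s) ^ 9 * exp (- (s ^ 2 / 2))).
Proof.
intros Ha. set (A := a + 1). set (H := exp (3 / 2 * A)).
assert (HH : 0 < H) by apply exp_pos.
assert (HA : 1 < A) by (unfold A; lra).
set (K1 := 343 * (A + 1) ^ 3 * (1 + H) + 2 * (A + 1) + 16 * (A + 1) ^ 2).
set (K2 := 8 * H + 8 + 6 * (A + 1) + (A + 1) ^ 2).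
assert (B3 : 0 < (A + 1) ^ 3) by (apply pow_lt; lra).
assert (B2 : 0 < (A + 1) ^ 2) by (apply pow_lt; lra).
assert (K1p : 0 < K1).
{ unfold K1. assert (0 < (A + 1) ^ 3 * (1 + H)) by (apply Rmult_lt_0_compat; lra). lra. }
assert (K2p : 0 < K2) by (unfold K2; lra).
exists (K1 + K2). split; [lra|].
intros e s He Hb Hs.
set (E := exp (- (s ^ 2 / 2))). assert (HE : 0 < E) by apply exp_pos.
set (T := 1 + e * lap1 A s + e ^ 2 * (lap2 A s + lap1 A s ^ 2 / 2)).
assert (X : 0 < e ^ 3 * (1 + s) ^ 9) by (apply Rmult_lt_0_compat; apply pow_lt; lra).
(* [g] is the kernel divided by the Gaussian: 0 beyond the support and [exp d] inside it. Estimating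
   [g] rather than the kernel keeps the factor [E] in the error. *)
assert (Hg : exists g, exp (s / e) * beta_weight e (/ e ^ 2 - a) s = E * g /\
   Rabs (g - T) <= (K1 + K2) * (e ^ 3 * (1 + s) ^ 9)).
{ destruct (Rle_lt_dec 1 (e * s)) as [H1|H1].
  - exists 0. split.
    + unfold beta_weight. rewrite pospow_neg by lra. ring.
    + eapply Rle_trans; [apply (lap_factor_far A e s 0); lra|].
      rewrite Rabs_R0. apply Rmult_le_compat_r; [lra|]. unfold K2; lra.
  - set (d := s / e + (/ e ^ 2 - A) * ln (1 - e * s) + s ^ 2 / 2).
    (* With [u = e * s < 1], the bound on [ln (1 - u)] cancels [s / e] and [s ^ 2 / 2] and leaves
       [A * (u + u ^ 2 / 2)]; this is the origin of [H]. *)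
    assert (Hd : d <= 3 / 2 * A).
    { assert (0 < e * s) by nra.
      assert (L := ln_one_minus_le (e * s) ltac:(lra)).
      apply Rmult_le_compat_l with (r := / e ^ 2 - A) in L; [|lra].
      replace ((/ e ^ 2 - A) * (- (e * s) - (e * s) ^ 2 / 2))
        with (- (s / e) - s ^ 2 / 2 + A * (e * s + (e * s) ^ 2 / 2)) in L by (field; lra).
      assert (A * (e * s + (e * s) ^ 2 / 2) <= A * (3 / 2)).
      { apply Rmult_le_compat_l; [lra|]. nra. }
      unfold d; lra. }
    assert (HgH : exp d <= H) by (apply exp_le; auto).
    pose proof (exp_pos d).
    exists (exp d). split.
    + unfold beta_weight, E. rewrite pospow_pos by lra.
      unfold Rpower. rewrite <- !exp_plus. f_equal. unfold d, A. field. lra.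
    + destruct (Rle_lt_dec (e * s) (1 / 2)).
      * eapply Rle_trans; [apply (lap_factor_near A e s); lra|].
        fold d. apply Rmult_le_compat_r; [lra|].
        assert ((A + 1) ^ 3 * (1 + exp d) <= (A + 1) ^ 3 * (1 + H)) by (apply Rmult_le_compat_l; lra).
        unfold K1; lra.
      * eapply Rle_trans; [apply (lap_factor_far A e s (exp d)); lra|].
        rewrite Rabs_pos_eq by lra. apply Rmult_le_compat_r; [lra|]. unfold K2; lra. }
destruct Hg as [g [-> Hg]].
replace (E * g - E * T) with (E * (g - T)) by ring.
rewrite Rabs_mult, (Rabs_pos_eq E) by lra.
apply Rmult_le_compat_l with (r := E) in Hg; [|lra].
eapply Rle_trans; [exact Hg|]. right; ring.
Qed.

Lemma gaussian_moment_domination (r : R) :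
  exists C, 0 < C /\ forall s, 0 < s ->
    exp (r * s) * ((1 + s) ^ 9 * exp (- (s ^ 2 / 2))) <= C * exp (- s).
Proof.
(* Maximum of [(10 + r) * s - s ^ 2 / 2]: 9 comes from [(1 + s) ^ 9 <= exp (9 * s)], and 1 from the
   decay [exp (- s)] to be kept. *)
exists (exp ((10 + r) ^ 2 / 2)). split; [apply exp_pos|].
intros s Hs.
assert (H : (1 + s) ^ 9 <= exp (9 * s)).
{ replace (exp (9 * s)) with (exp s ^ 9).
  - apply pow_incr. pose proof (exp_ineq1_le s). lra.
  - replace (9 * s) with (s + s + s + s + s + s + s + s + s) by ring. rewrite !exp_plus; ring. }
apply Rle_trans with (exp (r * s) * (exp (9 * s) * exp (- (s ^ 2 / 2)))).
- apply Rmult_le_compat_l; [left; apply exp_pos|].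
  apply Rmult_le_compat_r; auto. left; apply exp_pos.
- rewrite <- !exp_plus. apply exp_le. pose proof (pow2_ge_0 (s - (10 + r))). nra.
Qed.

(** * The complex exponential *)

Ltac as_R_eq := match goal with |- @eq _ ?x ?y => change (@eq R x y) end.

Lemma continuous_C_pair (f g : R -> R) (x : R) :
  continuous f x -> continuous g x ->
  continuous (U := C_R_NormedModule) (fun t => (f t, g t) : C) x.
Proof.
intros Hf Hg. apply filterlim_locally. intros eps.
pose proof (proj1 (filterlim_locally _ _) Hf eps) as F1.
pose proof (proj1 (filterlim_locally _ _) Hg eps) as F2.
generalize (filter_and _ _ F1 F2). apply filter_imp.
intros y [H1 H2]. split; assumption.
Qed.

Lemma is_pint_scal_C (f : R -> R) (l : R) (v : C) :
  is_pint f l ->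
  is_pint (fun s => scal (V := C_R_NormedModule) (f s) v) (scal (V := C_R_NormedModule) l v).
Proof.
intros Hf.
assert (HR : forall a b y, is_RInt f a b y ->
  is_RInt (V := C_R_NormedModule) (fun s => scal (V := C_R_NormedModule) (f s) v) a b
    (scal (V := C_R_NormedModule) y v)).
{ intros a b y Hy.
  apply (is_RInt_fct_extend_pair (U := R_NormedModule) (V := R_NormedModule)
    (fun s => scal (V := C_R_NormedModule) (f s) v) a b (y * fst v) (y * snd v)).
  - apply (is_RInt_ext (V := R_NormedModule) (fun s => scal (fst v) (f s))).
    + intros; apply Rmult_comm.
    + rewrite Rmult_comm. apply (is_RInt_scal (V := R_NormedModule)). exact Hy.
  - apply (is_RInt_ext (V := R_NormedModule) (fun s => scal (snd v) (f s))).
    + intros; apply Rmult_comm.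
    + rewrite Rmult_comm. apply (is_RInt_scal (V := R_NormedModule)). exact Hy. }
intros P HP.
assert (HQ : locally l (fun y => P (scal (V := C_R_NormedModule) y v))).
{ refine (continuous_C_pair (fun y => y * fst v) (fun y => y * snd v) l _ _ P HP);
  apply (ex_derive_continuous (V := R_NormedModule)); auto_derive; auto. }
pose proof (Hf _ HQ) as HF. unfold filtermapi in HF |- *.
revert HF. apply filter_imp.
intros [a b] [y [Hy Py]]. exists (scal (V := C_R_NormedModule) y v). split; auto.
Qed.

Lemma Cexp_plus (z w : C) : Cexp (z + w)%C = (Cexp z * Cexp w)%C.
Proof.
unfold Cexp, Cmult, Cplus; simpl. rewrite exp_plus, cos_plus, sin_plus.
f_equal; ring.
Qed.

Lemma Cmod_Cexp (z : C) : Cmod (Cexp z) = exp (fst z).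
Proof.
unfold Cexp, Cmod; simpl.
replace (_ + _) with (exp (fst z) ^ 2 * (Rsqr (sin (snd z)) + Rsqr (cos (snd z))))
  by (unfold Rsqr; ring).
rewrite sin2_cos2, Rmult_1_r. apply sqrt_pow2. left; apply exp_pos.
Qed.

Lemma Cexp_RtoC (x : R) : Cexp (RtoC x) = RtoC (exp x).
Proof.
unfold Cexp, RtoC; simpl. rewrite cos_0, sin_0. f_equal; ring.
Qed.

Lemma Cmod_scal (x : R) (z : C) : 0 <= x ->
  Cmod (scal (V := C_R_NormedModule) x z) = x * Cmod z.
Proof.
intros Hx. rewrite scal_R_Cmult, Cmod_mult, Cmod_R, Rabs_pos_eq; auto.
Qed.

Lemma fst_le_Cmod (z : C) : fst z <= Cmod z.
Proof.
apply Rle_trans with (1 := Rle_abs _). apply Rle_trans with (2 := Rmax_Cmod z). apply Rmax_l.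
Qed.

(* Projecting the curve on the direction of its endpoint reduces the claim to scalar functions. *)
Lemma Cmod_le_of_derive (E1 E2 g E1' E2' g' : R -> R) (t : R) : 0 <= t ->
  (forall s, 0 <= s <= t -> is_derive E1 s (E1' s)) ->
  (forall s, 0 <= s <= t -> is_derive E2 s (E2' s)) ->
  (forall s, 0 <= s <= t -> is_derive g s (g' s)) ->
  E1 0 = 0 -> E2 0 = 0 -> g 0 = 0 ->
  (forall s, 0 <= s <= t -> Cmod (E1' s, E2' s) <= g' s) ->
  Cmod (E1 t, E2 t) <= g t.
Proof.
intros Ht D1 D2 D3 Z1 Z2 Z3 Hle.
set (v1 := E1 t). set (v2 := E2 t). set (m := Cmod (v1, v2)).
assert (Hm : 0 <= m) by apply Cmod_ge_0.
assert (Hm2 : m * m = v1 * v1 + v2 * v2).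
{ unfold m, Cmod. rewrite sqrt_sqrt; simpl; nra. }
assert (H : 0 <= m * g t - (v1 * E1 t + v2 * E2 t)).
{ apply (nonneg_of_derive (fun s => m * g s - (v1 * E1 s + v2 * E2 s))
    (fun s => m * g' s - (v1 * E1' s + v2 * E2' s))); auto.
  - intros s Hs.
    apply (is_derive_minus (V := R_NormedModule) (fun s => m * g s) (fun s => v1 * E1 s + v2 * E2 s)).
    + apply (is_derive_scal g s m); auto.
    + apply (is_derive_plus (V := R_NormedModule) (fun s => v1 * E1 s) (fun s => v2 * E2 s)).
      apply (is_derive_scal E1 s v1); auto. apply (is_derive_scal E2 s v2); auto.
  - intros s Hs. specialize (Hle s Hs).
    set (n := Cmod (E1' s, E2' s)) in *.
    assert (Hn : 0 <= n) by apply Cmod_ge_0.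
    assert (Hn2 : n * n = E1' s * E1' s + E2' s * E2' s).
    { unfold n, Cmod. rewrite sqrt_sqrt; simpl; nra. }
    (* Cauchy-Schwarz in the plane, through Lagrange's identity. *)
    assert (v1 * E1' s + v2 * E2' s <= m * n).
    { apply Rsqr_incr_0_var; [|nra]. unfold Rsqr.
      replace (m * n * (m * n)) with ((m * m) * (n * n)) by ring. rewrite Hm2, Hn2.
      assert (0 <= (v1 * E2' s - v2 * E1' s) * (v1 * E2' s - v2 * E1' s)) by apply Rle_0_sqr. nra. }
    nra.
  - rewrite Z1, Z2, Z3; ring. }
fold v1 v2 in H. rewrite <- Hm2 in H.
(* If the endpoint is 0 it has no direction to project on; the claim is then [0 <= g t], and [g] is
   nondecreasing because [g'] dominates a modulus. *)
destruct (Rle_lt_or_eq_dec 0 m Hm) as [Hp|Hz]; [nra|].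
rewrite <- Hz. rewrite <- Z3.
assert (0 <= g t - g 0); [|lra].
apply (nonneg_of_derive (fun s => g s - g 0) g'); auto.
- intros s Hs. replace (g' s) with (minus (g' s) 0) by (unfold minus, plus, opp; simpl; ring).
  apply (is_derive_minus (V := R_NormedModule) g (fun _ => g 0)); auto.
  apply (is_derive_const (V := R_NormedModule)).
- intros s Hs. apply Rle_trans with (2 := Hle s Hs). apply Cmod_ge_0.
- ring.
Qed.

(** * Remainder of the exponential series along a ray *)

Definition Cexp_term (z : C) (k : nat) : C := (RtoC (/ INR (fact k)) * z ^ k)%C.

(** With [n] terms rather than [n + 1], inductions start from the empty sum; [sum_n] up to [n]
    corresponds to [Csum f (S n)]. *)
Fixpoint Csum (f : nat -> C) (n : nat) : C :=
  match n with O => RtoC 0 | S m => (Csum f m + f m)%C end.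

Lemma RtoC_pow_mult (t : R) (w : C) (k : nat) :
  ((RtoC t * w) ^ k = RtoC (t ^ k) * w ^ k)%C.
Proof.
induction k as [|k IH]; simpl.
- unfold RtoC, Cmult; simpl; f_equal; ring.
- rewrite IH, RtoC_mult. ring.
Qed.

Lemma fst_RtoC_mult (x : R) (z : C) : fst (RtoC x * z)%C = x * fst z.
Proof. simpl; ring. Qed.
Lemma snd_RtoC_mult (x : R) (z : C) : snd (RtoC x * z)%C = x * snd z.
Proof. simpl; ring. Qed.

Lemma Cexp_term_RtoC_mult (t : R) (w : C) (k : nat) :
  Cexp_term (RtoC t * w) k = (RtoC (t ^ k / INR (fact k)) * w ^ k)%C.
Proof.
unfold Cexp_term. rewrite RtoC_pow_mult. unfold Rdiv.
rewrite RtoC_mult. ring.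
Qed.

Lemma is_derive_Cexp_term (w : C) (k : nat) (t : R) :
  is_derive (fun t => fst (Cexp_term (RtoC t * w) (S k))) t (fst (w * Cexp_term (RtoC t * w) k)%C) /\
  is_derive (fun t => snd (Cexp_term (RtoC t * w) (S k))) t (snd (w * Cexp_term (RtoC t * w) k)%C).
Proof.
assert (Hk : INR k + 1 <> 0) by (pose proof (pos_INR k); lra).
assert (Hf := INR_fact_neq_0 k).
assert (E : (w * Cexp_term (RtoC t * w) k = RtoC (t ^ k / INR (fact k)) * w ^ S k)%C).
{ rewrite Cexp_term_RtoC_mult. simpl. ring. }
rewrite E.
assert (HD : is_derive (fun t => t ^ S k / INR (fact (S k))) t (t ^ k / INR (fact k))).
{ rewrite fact_simpl, mult_INR, S_INR. auto_derive; auto.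
  change (match k with O => 1 | S _ => INR k + 1 end) with (INR (S k)). rewrite S_INR.
  simpl. field. split; auto. }
split.
- apply (is_derive_ext (fun t => fst (w ^ S k)%C * (t ^ S k / INR (fact (S k))))).
  { intros s. rewrite Cexp_term_RtoC_mult, fst_RtoC_mult. as_R_eq; ring. }
  rewrite fst_RtoC_mult, Rmult_comm. apply (is_derive_scal (fun t => t ^ S k / INR (fact (S k)))). exact HD.
- apply (is_derive_ext (fun t => snd (w ^ S k)%C * (t ^ S k / INR (fact (S k))))).
  { intros s. rewrite Cexp_term_RtoC_mult, snd_RtoC_mult. as_R_eq; ring. }
  rewrite snd_RtoC_mult, Rmult_comm. apply (is_derive_scal (fun t => t ^ S k / INR (fact (S k)))). exact HD.
Qed.

Lemma is_derive_Cexp_sum (w : C) (n : nat) (t : R) :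
  is_derive (fun t => fst (Csum (Cexp_term (RtoC t * w)) (S n))) t
    (fst (w * Csum (Cexp_term (RtoC t * w)) n)%C) /\
  is_derive (fun t => snd (Csum (Cexp_term (RtoC t * w)) (S n))) t
    (snd (w * Csum (Cexp_term (RtoC t * w)) n)%C).
Proof.
induction n as [|n [IH1 IH2]].
- split.
  + apply (is_derive_ext (fun _ => 1)).
    { intros s. unfold Csum, Cexp_term; simpl. as_R_eq; field. }
    replace (fst (w * Csum (Cexp_term (RtoC t * w)) 0)%C) with 0 by (simpl; ring).
    apply (is_derive_const (V := R_NormedModule)).
  + apply (is_derive_ext (fun _ => 0)).
    { intros s. unfold Csum, Cexp_term; simpl. as_R_eq; field. }
    replace (snd (w * Csum (Cexp_term (RtoC t * w)) 0)%C) with 0 by (simpl; ring).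
    apply (is_derive_const (V := R_NormedModule)).
- destruct (is_derive_Cexp_term w n t) as [D1 D2].
  replace (w * Csum (Cexp_term (RtoC t * w)) (S n))%C
    with (w * Csum (Cexp_term (RtoC t * w)) n + w * Cexp_term (RtoC t * w) n)%C
    by (simpl; ring).
  split.
  + apply (is_derive_plus (V := R_NormedModule) (fun t => fst (Csum (Cexp_term (RtoC t * w)) (S n)))
      (fun t => fst (Cexp_term (RtoC t * w) (S n)))); auto.
  + apply (is_derive_plus (V := R_NormedModule) (fun t => snd (Csum (Cexp_term (RtoC t * w)) (S n)))
      (fun t => snd (Cexp_term (RtoC t * w) (S n)))); auto.
Qed.

Lemma is_derive_Cexp (w : C) (t : R) :
  is_derive (fun t => fst (Cexp (RtoC t * w))) t (fst (w * Cexp (RtoC t * w))%C) /\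
  is_derive (fun t => snd (Cexp (RtoC t * w))) t (snd (w * Cexp (RtoC t * w))%C).
Proof.
destruct w as [u v]. unfold Cexp; simpl. split; auto_derive; auto; unfold Rminus; ring.
Qed.

Lemma Csum_Cexp_term_0 (w : C) (n : nat) : Csum (Cexp_term (RtoC 0 * w)) (S n) = RtoC 1.
Proof.
induction n as [|n IH].
- simpl. unfold Cexp_term; simpl. rewrite Rinv_1. ring.
- change (Csum (Cexp_term (RtoC 0 * w)) (S n) + Cexp_term (RtoC 0 * w) (S n) = RtoC 1)%C.
  rewrite IH, Cexp_term_RtoC_mult. rewrite pow_i by lia.
  replace (0 / INR (fact (S n))) with 0 by (unfold Rdiv; ring). ring.
Qed.

(** Along the ray, the error after [n + 1] terms has derivative [w] times the error after [n] terms.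
    The derivative of the bound contains [Cmod w] times the previous bound plus a nonnegative term,
    so [Cmod_le_of_derive] carries the induction; the factor [exp (Cmod w * t)] is what the case
    [n = 0] requires. *)
Lemma Cexp_remainder (w : C) (n : nat) (t : R) : 0 <= t ->
  Cmod (Cexp (RtoC t * w) - Csum (Cexp_term (RtoC t * w)) n)%C
  <= (Cmod w * t) ^ n / INR (fact n) * exp (Cmod w * t).
Proof.
set (W := Cmod w). assert (HW : 0 <= W) by apply Cmod_ge_0.
revert t. induction n as [|n IH]; intros t Ht.
- replace (Cexp (RtoC t * w) - Csum (Cexp_term (RtoC t * w)) 0)%C with (Cexp (RtoC t * w))
    by (simpl; ring).
  rewrite Cmod_Cexp. simpl. replace (1 / 1) with 1 by field. rewrite Rmult_1_l.
  apply exp_le. rewrite Rmult_0_l, Rminus_0_r, Rmult_comm.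
  apply Rmult_le_compat_r; auto. apply fst_le_Cmod.
- set (Er := fun (n : nat) (t : R) => (Cexp (RtoC t * w) - Csum (Cexp_term (RtoC t * w)) n)%C).
  assert (Hf : 0 < INR (fact n)) by apply INR_fact_lt_0.
  assert (Hk : 0 < INR n + 1) by (pose proof (pos_INR n); lra).
  change (Cmod (fst (Er (S n) t), snd (Er (S n) t)) <= (W * t) ^ S n / INR (fact (S n)) * exp (W * t)).
  apply (Cmod_le_of_derive (fun t => fst (Er (S n) t)) (fun t => snd (Er (S n) t))
    (fun t => (W * t) ^ S n / INR (fact (S n)) * exp (W * t))
    (fun t => fst (w * Er n t)%C) (fun t => snd (w * Er n t)%C)
    (fun t => W * ((W * t) ^ n / INR (fact n) * exp (W * t))
       + W * ((W * t) ^ S n / INR (fact (S n)) * exp (W * t)))); auto.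
  + intros s Hs.
    replace (w * Er n s)%C with (w * Cexp (RtoC s * w) - w * Csum (Cexp_term (RtoC s * w)) n)%C
      by (unfold Er; ring).
    apply (is_derive_minus (V := R_NormedModule) (fun t => fst (Cexp (RtoC t * w)))
      (fun t => fst (Csum (Cexp_term (RtoC t * w)) (S n)))).
    apply is_derive_Cexp. apply is_derive_Cexp_sum.
  + intros s Hs.
    replace (w * Er n s)%C with (w * Cexp (RtoC s * w) - w * Csum (Cexp_term (RtoC s * w)) n)%C
      by (unfold Er; ring).
    apply (is_derive_minus (V := R_NormedModule) (fun t => snd (Cexp (RtoC t * w)))
      (fun t => snd (Csum (Cexp_term (RtoC t * w)) (S n)))).
    apply is_derive_Cexp. apply is_derive_Cexp_sum.
  + intros s Hs. rewrite fact_simpl, mult_INR, S_INR. auto_derive; auto.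
    change (match n with O => 1 | S _ => INR n + 1 end) with (INR (S n)). rewrite S_INR.
    simpl. field. split; lra.
  + unfold Er. rewrite Csum_Cexp_term_0. unfold Cexp; simpl.
    rewrite !Rmult_0_l, Rminus_0_r, Rplus_0_r, exp_0, cos_0. ring.
  + unfold Er. rewrite Csum_Cexp_term_0. unfold Cexp; simpl.
    rewrite !Rmult_0_l, Rplus_0_r, sin_0. ring.
  + rewrite Rmult_0_r, pow_i by lia. unfold Rdiv; ring.
  + intros s Hs. rewrite <- surjective_pairing. rewrite Cmod_mult. fold W.
    specialize (IH s (proj1 Hs)). fold (Er n s) in IH.
    assert (W * Cmod (Er n s) <= W * ((W * s) ^ n / INR (fact n) * exp (W * s))) by (apply Rmult_le_compat_l; auto).
    assert (0 <= W * ((W * s) ^ S n / INR (fact (S n)) * exp (W * s))); [|lra].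
    apply Rmult_le_pos; auto. apply Rmult_le_pos; [|left; apply exp_pos].
    apply Rmult_le_pos; [|left; apply Rinv_0_lt_compat, INR_fact_lt_0].
    apply pow_le. apply Rmult_le_pos; lra.
Qed.

(** * Euler's integral for 1F1 and the asymptotic expansion *)

Ltac as_C_eq := match goal with |- @eq _ ?x ?y => change (@eq C x y) end.

Notation Cscal := (scal (V := C_R_NormedModule)).

(** The factor [e ^ k] of [(e s) ^ k] cancels the [/ e ^ k] of the shifted moment, so the integrated
    term no longer depends on [e] except through [m]. *)
Lemma is_pint_Cexp_term (a c e m : R) (z : C) (k : nat) : 0 < a -> 3 <= c -> 0 < e <= 1 ->
  is_moment (beta_weight e c) a m ->
  is_pint (fun s => Cscal (Rpower s (a - 1) * beta_weight e c s) (Cexp_term (RtoC (e * s) * z) k))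
    (Cscal m (hyp1F1_term a (a + c) z k)).
Proof.
intros Ha Hc He Hm.
destruct (beta_moment_exists e c (a + INR k)) as [mk Hmk]; try lra.
{ pose proof (pos_INR k); lra. }
assert (E := beta_moment_poch e c a m mk k He Hc Ha Hm Hmk).
assert (Hf := INR_fact_lt_0 k).
assert (Hp : 0 < poch (a + c) k) by (apply poch_pos; lra).
assert (He' : 0 < e ^ k) by (apply pow_lt; lra).
replace (Cscal m (hyp1F1_term a (a + c) z k)) with (Cscal (scal (e ^ k / INR (fact k)) mk) (z ^ k)%C).
2:{ unfold hyp1F1_term. rewrite !scal_R_Cmult, Cmult_assoc, <- RtoC_mult. f_equal. f_equal.
  rewrite E. unfold scal; simpl; unfold mult; simpl. field. lra. }
refine (is_pint_ext (V := C_R_NormedModule) _ _ _ _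
  (is_pint_scal_C _ _ _ (is_RInt_gen_scal (V := R_NormedModule) _ (e ^ k / INR (fact k)) _ Hmk))).
intros s Hs. rewrite Cexp_term_RtoC_mult, !scal_R_Cmult, Cmult_assoc, <- RtoC_mult. f_equal. f_equal.
unfold scal; simpl; unfold mult; simpl.
replace (a + INR k - 1) with (a - 1 + INR k) by ring.
rewrite Rpower_plus, Rpower_pow, Rpow_mult_distr by auto. unfold Rdiv; ring.
Qed.

Lemma is_pint_Cexp_sum (a c e m : R) (z : C) (n : nat) : 0 < a -> 3 <= c -> 0 < e <= 1 ->
  is_moment (beta_weight e c) a m ->
  is_pint (fun s => Cscal (Rpower s (a - 1) * beta_weight e c s)
      (Csum (Cexp_term (RtoC (e * s) * z)) n))
    (Cscal m (Csum (hyp1F1_term a (a + c) z) n)).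
Proof.
intros Ha Hc He Hm. induction n as [|n IH].
- apply is_pint_scal_C. exact Hm.
- replace (Cscal m (Csum (hyp1F1_term a (a + c) z) (S n))) with
    (plus (Cscal m (Csum (hyp1F1_term a (a + c) z) n)) (Cscal m (hyp1F1_term a (a + c) z n)))
    by (symmetry; apply (scal_distr_l (V := C_R_NormedModule))).
  refine (is_pint_ext (V := C_R_NormedModule) _ _ _ _
    (is_RInt_gen_plus _ _ _ _ IH (is_pint_Cexp_term a c e m z n Ha Hc He Hm))).
  intros s Hs. symmetry. apply (scal_distr_l (V := C_R_NormedModule)).
Qed.

Lemma Csum_fst (f : nat -> C) (n : nat) :
  sum_n (fun k => fst (f k)) n = fst (Csum f (S n)).
Proof.
induction n as [|n IH].
- rewrite sum_O. simpl. ring.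
- rewrite sum_Sn, IH. reflexivity.
Qed.

Lemma Csum_snd (f : nat -> C) (n : nat) :
  sum_n (fun k => snd (f k)) n = snd (Csum f (S n)).
Proof.
induction n as [|n IH].
- rewrite sum_O. simpl. ring.
- rewrite sum_Sn, IH. reflexivity.
Qed.

Lemma Series_of_error (u err : nat -> R) (l : R) :
  (forall n, Rabs (sum_n u n - l) <= err n) -> is_lim_seq err 0 -> Series u = l.
Proof.
intros H He. apply is_series_unique.
change (is_lim_seq (sum_n u) l).
apply (is_lim_seq_le_le (fun n => l - err n) _ (fun n => l + err n)).
- intros n. specialize (H n). apply Rabs_le_between in H. lra.
- replace (Finite l) with (Finite (l - 0)) by (f_equal; ring).
  apply is_lim_seq_minus'; auto. apply is_lim_seq_const.
- replace (Finite l) with (Finite (l + 0)) by (f_equal; ring).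
  apply is_lim_seq_plus'; auto. apply is_lim_seq_const.
Qed.

(* Since the weight vanishes for [e * s >= 1], the exponential series converges uniformly and can be integrated termwise. *)
Lemma hyp1F1_integral (a c e m : R) (z L : C) : 0 < a -> 3 <= c -> 0 < e <= 1 ->
  is_moment (beta_weight e c) a m ->
  is_pint (fun s => Cscal (Rpower s (a - 1) * beta_weight e c s) (Cexp (RtoC (e * s) * z))) L ->
  hyp1F1 a (a + c) z = (RtoC (/ m) * L)%C.
Proof.
intros Ha Hc He Hm HL.
assert (Hmp : 0 < m) by (apply (beta_moment_pos e c a m); auto).
set (Z := Cmod z). assert (HZ : 0 <= Z) by apply Cmod_ge_0.
assert (HB : forall n, Cmod (RtoC (/ m) * L - Csum (hyp1F1_term a (a + c) z) n)%C
    <= exp Z * (Z ^ n / INR (fact n))).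
{ intros n. set (K := exp Z * (Z ^ n / INR (fact n))).
  assert (HK : 0 <= K).
  { apply Rmult_le_pos; [left; apply exp_pos|]. apply Rmult_le_pos; [apply pow_le; auto|].
    left; apply Rinv_0_lt_compat, INR_fact_lt_0. }
  assert (H : norm (V := C_R_NormedModule) (minus (G := C_R_NormedModule) L
    (Cscal m (Csum (hyp1F1_term a (a + c) z) n))) <= scal K m).
  { refine (is_pint_norm_le (V := C_R_CompleteNormedModule) _ _ _ _ _
      (is_RInt_gen_minus _ _ _ _ HL (is_pint_Cexp_sum a c e m z n Ha Hc He Hm))
      (is_RInt_gen_scal _ K _ Hm)).
    intros s Hs.
    assert (HR := Cexp_remainder z n (e * s) ltac:(nra)). fold Z in HR.
    set (X := Cexp (RtoC (e * s) * z)) in *.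
    set (Y := Csum (Cexp_term (RtoC (e * s) * z)) n) in *.
    pose proof (beta_weight_ge0 e c s) as Hw. pose proof (Rpower_pos s (a - 1)) as Hr.
    set (w := Rpower s (a - 1) * beta_weight e c s).
    assert (Hw0 : 0 <= w) by (apply Rmult_le_pos; lra).
    change (norm (V := C_R_NormedModule) (Cscal w X - Cscal w Y)%C <= K * w).
    rewrite <- Cmod_norm.
    replace (Cscal w X - Cscal w Y)%C with (Cscal w (X - Y)%C).
    2:{ rewrite !scal_R_Cmult. as_C_eq; ring. }
    rewrite Cmod_scal by auto. rewrite Rmult_comm.
    destruct (Rle_lt_dec 1 (e * s)) as [H1|H1].
    - assert (Ew : w = 0).
      { unfold w, beta_weight. rewrite pospow_neg by lra. ring. }
      rewrite Ew; lra.
    - apply Rmult_le_compat_r; auto. apply Rle_trans with (1 := HR).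
      unfold K. rewrite Rmult_comm.
      assert (0 <= e * s) by nra. assert (Z * (e * s) <= Z) by nra.
      assert (0 <= Z * (e * s)) by nra.
      apply Rmult_le_compat.
      + left; apply exp_pos.
      + apply Rmult_le_pos; [apply pow_le; auto|]. left; apply Rinv_0_lt_compat, INR_fact_lt_0.
      + apply exp_le; auto.
      + apply Rmult_le_compat_r; [left; apply Rinv_0_lt_compat, INR_fact_lt_0|].
        apply pow_incr; auto. }
  rewrite <- Cmod_norm in H.
  change (Cmod (L - Cscal m (Csum (hyp1F1_term a (a + c) z) n))%C <= K * m) in H.
  rewrite scal_R_Cmult in H.
  replace (RtoC (/ m) * L - Csum (hyp1F1_term a (a + c) z) n)%C
    with (RtoC (/ m) * (L - RtoC m * Csum (hyp1F1_term a (a + c) z) n))%C.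
  2:{ replace (Csum (hyp1F1_term a (a + c) z) n) with
        (RtoC (/ m) * RtoC m * Csum (hyp1F1_term a (a + c) z) n)%C at 2.
      - ring.
      - rewrite <- RtoC_mult, Rinv_l by lra. ring. }
  rewrite Cmod_mult, Cmod_R, Rabs_pos_eq by (left; apply Rinv_0_lt_compat; auto).
  apply Rmult_le_reg_l with m; auto.
  rewrite <- Rmult_assoc, Rinv_r, Rmult_1_l by lra. lra. }
assert (Hlim : is_lim_seq (fun n => exp Z * (Z ^ S n / INR (fact (S n)))) 0).
{ replace (Finite 0) with (Rbar_mult (exp Z) 0) by (simpl; f_equal; ring).
  apply is_lim_seq_scal_l. apply (is_lim_seq_incr_1 (fun n => Z ^ n / INR (fact n))).
  apply is_lim_seq_Reals. apply cv_speed_pow_fact. }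
set (M := (RtoC (/ m) * L)%C) in *.
rewrite (surjective_pairing M). unfold hyp1F1. f_equal.
- apply (Series_of_error _ _ _) with (2 := Hlim). intros n.
  rewrite Csum_fst. apply Rle_trans with (2 := HB (S n)).
  rewrite Rabs_minus_sym.
  replace (fst M - fst (Csum (hyp1F1_term a (a + c) z) (S n)))
    with (fst (M - Csum (hyp1F1_term a (a + c) z) (S n))%C) by (simpl; ring).
  apply Rle_trans with (2 := Rmax_Cmod _). apply Rmax_l.
- apply (Series_of_error _ _ _) with (2 := Hlim). intros n.
  rewrite Csum_snd. apply Rle_trans with (2 := HB (S n)).
  rewrite Rabs_minus_sym.
  replace (snd M - snd (Csum (hyp1F1_term a (a + c) z) (S n)))
    with (snd (M - Csum (hyp1F1_term a (a + c) z) (S n))%C) by (simpl; ring).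
  apply Rle_trans with (2 := Rmax_Cmod _). apply Rmax_r.
Qed.

(** * Laplace integrals and parabolic cylinder functions *)

Definition is_laplace (w : R -> R) (zeta L : C) : Prop :=
  is_pint (fun s => Cscal (w s) (Cexp (RtoC s * zeta))) L.

Lemma norm_laplace_integrand (w : R -> R) (zeta : C) (s : R) : 0 < s ->
  norm (V := C_R_NormedModule) (Cscal (w s) (Cexp (RtoC s * zeta))) <= Rabs (w s) * exp (Cmod zeta * s).
Proof.
intros Hs. rewrite <- Cmod_norm, scal_R_Cmult, Cmod_mult, Cmod_R, Cmod_Cexp.
apply Rmult_le_compat_l; [apply Rabs_pos|]. apply exp_le.
rewrite fst_RtoC_mult, Rmult_comm. apply Rmult_le_compat_r; [lra|]. apply fst_le_Cmod.
Qed.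

Lemma is_laplace_exists (w : R -> R) (K x : R) (zeta : C) : 0 < x ->
  (forall s, 0 < s -> continuous w s) ->
  (forall s, 0 < s -> Rabs (w s) * exp (Cmod zeta * s) <= K * (Rpower s (x - 1) * exp (- s))) ->
  exists L, is_laplace w zeta L.
Proof.
intros Hx Hc Hb.
apply (ex_pint_moment (V := C_R_CompleteNormedModule) _ K x Hx).
- intros s Hs.
  destruct (is_derive_Cexp zeta s) as [D1 D2].
  apply (continuous_C_pair (fun s => w s * fst (Cexp (RtoC s * zeta))) (fun s => w s * snd (Cexp (RtoC s * zeta)))).
  + apply (continuous_mult (K := R_AbsRing) w (fun s => fst (Cexp (RtoC s * zeta)))); auto.
    apply (ex_derive_continuous (V := R_NormedModule)). eexists; exact D1.
  + apply (continuous_mult (K := R_AbsRing) w (fun s => snd (Cexp (RtoC s * zeta)))); auto.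
    apply (ex_derive_continuous (V := R_NormedModule)). eexists; exact D2.
- intros s Hs. apply Rle_trans with (2 := Hb s Hs). apply norm_laplace_integrand; auto.
Qed.

Lemma is_laplace_bound (w : R -> R) (K x : R) (zeta L : C) : 0 < x ->
  (forall s, 0 < s -> Rabs (w s) * exp (Cmod zeta * s) <= K * (Rpower s (x - 1) * exp (- s))) ->
  is_laplace w zeta L -> Cmod L <= K * Gamma x.
Proof.
intros Hx Hb HL. rewrite Cmod_norm.
refine (is_pint_norm_le (V := C_R_CompleteNormedModule) _ _ _ _ _ HL
  (is_RInt_gen_scal (V := R_NormedModule) _ K _ (Gamma_correct x Hx))).
intros s Hs. apply Rle_trans with (2 := Hb s Hs). apply norm_laplace_integrand; auto.
Qed.

Lemma is_laplace_ext (w w' : R -> R) (zeta L : C) :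
  (forall s, 0 < s -> w s = w' s) -> is_laplace w zeta L -> is_laplace w' zeta L.
Proof.
intros H HL.
refine (is_pint_ext (V := C_R_NormedModule) _ _ _ _ HL).
intros s Hs. rewrite H; auto.
Qed.

Lemma is_laplace_plus (w w' : R -> R) (zeta L L' : C) :
  is_laplace w zeta L -> is_laplace w' zeta L' ->
  is_laplace (fun s => w s + w' s) zeta (L + L')%C.
Proof.
intros H H'.
refine (is_pint_ext (V := C_R_NormedModule) _ _ _ _ (is_RInt_gen_plus _ _ _ _ H H')).
intros s Hs. symmetry. apply (scal_distr_r (V := C_R_NormedModule)).
Qed.

Lemma is_laplace_scal (w : R -> R) (k : R) (zeta L : C) :
  is_laplace w zeta L -> is_laplace (fun s => k * w s) zeta (RtoC k * L)%C.
Proof.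
intros H. rewrite <- scal_R_Cmult.
refine (is_pint_ext (V := C_R_NormedModule) _ _ _ _ (is_RInt_gen_scal _ k _ H)).
intros s Hs. rewrite !scal_R_Cmult, RtoC_mult. as_C_eq; ring.
Qed.

Definition gauss_weight (x s : R) : R := Rpower s (x - 1) * exp (- (s ^ 2 / 2)).

Lemma gauss_weight_laplace_exists (x : R) (zeta : C) : 0 < x ->
  exists J, is_laplace (gauss_weight x) zeta J.
Proof.
intros Hx. destruct (gaussian_moment_domination (Cmod zeta)) as [K [HK Hd]].
apply (is_laplace_exists _ K x); auto.
- intros s Hs. unfold gauss_weight.
  apply (continuous_mult (K := R_AbsRing) (fun s => Rpower s (x - 1)) (fun s => exp (- (s ^ 2 / 2)))).
  + apply continuous_Rpower; auto.
  + apply (ex_derive_continuous (V := R_NormedModule)). auto_derive; auto.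
- intros s Hs. unfold gauss_weight.
  pose proof (Rpower_pos s (x - 1)). pose proof (exp_pos (- (s ^ 2 / 2))). pose proof (exp_pos (Cmod zeta * s)).
  rewrite Rabs_pos_eq by (apply Rmult_le_pos; lra).
  specialize (Hd s Hs).
  assert (1 <= (1 + s) ^ 9) by (apply pow_R1_Rle; lra).
  assert (exp (Cmod zeta * s) * exp (- (s ^ 2 / 2)) <= exp (Cmod zeta * s) * ((1 + s) ^ 9 * exp (- (s ^ 2 / 2)))).
  { apply Rmult_le_compat_l; [lra|]. nra. }
  replace (Rpower s (x - 1) * exp (- (s ^ 2 / 2)) * exp (Cmod zeta * s))
    with (Rpower s (x - 1) * (exp (Cmod zeta * s) * exp (- (s ^ 2 / 2)))) by ring.
  replace (K * (Rpower s (x - 1) * exp (- s))) with (Rpower s (x - 1) * (K * exp (- s))) by ring.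
  apply Rmult_le_compat_l; lra.
Qed.

(** The variable [nu] is separate from [x] so that [PCF (- a - 3)] can be rewritten with
    [x = a + INR 3], the form produced by multiplying the weight by [s ^ 3]. *)
Lemma PCF_laplace (x nu : R) (zeta J : C) : 0 < x -> nu = - x ->
  is_laplace (gauss_weight x) zeta J ->
  PCF nu (- zeta) = (RtoC (/ Gamma x) * (Cexp (- (zeta * zeta / RtoC 4)) * J))%C.
Proof.
intros Hx -> HJ. unfold PCF. rewrite Ropp_involutive.
assert (E : forall f, (forall s, 0 < s -> f s = Cscal (gauss_weight x s) (Cexp (RtoC s * zeta))) ->
   @RInt_gen C_R_CompleteNormedModule f (at_right 0) (Rbar_locally p_infty) = J).
{ intros f Hf. apply (is_RInt_gen_unique (V := C_R_CompleteNormedModule)).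
  refine (is_pint_ext (V := C_R_NormedModule) _ _ _ _ HJ).
  intros s Hs. symmetry; auto. }
rewrite E.
- replace (- (- zeta * - zeta) / RtoC 4)%C with (- (zeta * zeta / RtoC 4))%C.
  + unfold Cdiv. rewrite RtoC_inv by (apply Rgt_not_eq, Gamma_pos; auto). ring.
  + unfold Cdiv. ring.
- intros s Hs. rewrite scal_R_Cmult. unfold gauss_weight.
  replace (- (- zeta * RtoC s) - RtoC (s * s / 2))%C with (RtoC s * zeta + RtoC (- (s ^ 2 / 2)))%C.
  + rewrite Cexp_plus, Cexp_RtoC, RtoC_mult. as_C_eq; ring.
  + replace (- (s ^ 2 / 2)) with (- (s * s / 2)) by field. rewrite RtoC_opp. ring.
Qed.

Lemma gauss_weight_shift (x s : R) (k : nat) : 0 < s ->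
  gauss_weight (x + INR k) s = s ^ k * gauss_weight x s.
Proof.
intros Hs. unfold gauss_weight. replace (x + INR k - 1) with (x - 1 + INR k) by ring.
rewrite Rpower_plus, Rpower_pow by auto. ring.
Qed.

(** The products of [a], [a + 1], [a + 2] are absorbed by [Gamma (a + 1)] and [Gamma (a + 3)]; the
    remaining coefficients are those of [lap1 (a + 1)]. *)
Lemma B6_A1_laplace (a : R) (zeta J1 J3 : C) : 0 < a ->
  is_laplace (gauss_weight (a + INR 1)) zeta J1 ->
  is_laplace (gauss_weight (a + INR 3)) zeta J3 ->
  B6_A1 a zeta = (RtoC (/ Gamma a) * (Cexp (- (zeta * zeta / RtoC 4)) *
    (RtoC (a + 1) * J1 + RtoC (- (1 / 3)) * J3)))%C.
Proof.
intros Ha H1 H3. assert (G := Gamma_pos a Ha). unfold B6_A1.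
rewrite (PCF_laplace (a + INR 1) (- a - 1) zeta J1) by (auto; simpl; lra).
rewrite (PCF_laplace (a + INR 3) (- a - 3) zeta J3) by (auto; simpl; lra).
assert (E1 : Gamma (a + INR 1) = a * Gamma a) by (simpl; apply Gamma_succ; auto).
assert (E3 : Gamma (a + INR 3) = (a + 2) * ((a + 1) * (a * Gamma a))).
{ replace (a + INR 3) with (a + 1 + 1 + 1) by (simpl; ring). rewrite !Gamma_succ by lra. ring. }
rewrite E1, E3.
replace (/ (a * Gamma a)) with (/ a * / Gamma a) by (field; lra).
replace (/ ((a + 2) * ((a + 1) * (a * Gamma a)))) with (/ (a * (a + 1) * (a + 2)) * / Gamma a) by (field; lra).
transitivity (RtoC (/ Gamma a) * (Cexp (- (zeta * zeta / RtoC 4)) *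
  (RtoC (a * (a + 1) * / a) * J1 - RtoC (a * (a + 1) * (a + 2) / 3 * / (a * (a + 1) * (a + 2))) * J3)))%C.
{ rewrite !RtoC_mult. ring. }
replace (a * (a + 1) * / a) with (a + 1) by (field; lra).
replace (a * (a + 1) * (a + 2) / 3 * / (a * (a + 1) * (a + 2))) with (1 / 3) by (field; lra).
rewrite RtoC_opp. ring.
Qed.

(** What remains are the coefficients of [lap2 A s + lap1 A s ^ 2 / 2] at [A = a + 1]:
    [A * (A + 1) / 2] for [s ^ 2], where both parts contribute, [- (1 / 4 + A / 3)] for [s ^ 4], and
    [1 / 18] for [s ^ 6]. *)
Lemma B6_A2_laplace (a : R) (zeta J2 J4 J6 : C) : 0 < a ->
  is_laplace (gauss_weight (a + INR 2)) zeta J2 ->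
  is_laplace (gauss_weight (a + INR 4)) zeta J4 ->
  is_laplace (gauss_weight (a + INR 6)) zeta J6 ->
  B6_A2 a zeta = (RtoC (/ Gamma a) * (Cexp (- (zeta * zeta / RtoC 4)) *
    (RtoC ((a + 1) * (a + 2) / 2) * J2 + RtoC (- (1 / 4 + (a + 1) / 3)) * J4 + RtoC (1 / 18) * J6)))%C.
Proof.
intros Ha H2 H4 H6. assert (G := Gamma_pos a Ha). unfold B6_A2.
rewrite (PCF_laplace (a + INR 2) (- a - 2) zeta J2) by (auto; simpl; lra).
rewrite (PCF_laplace (a + INR 4) (- a - 4) zeta J4) by (auto; simpl; lra).
rewrite (PCF_laplace (a + INR 6) (- a - 6) zeta J6) by (auto; simpl; lra).
replace (a + INR 4) with (a + 4) by (simpl; ring).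
replace (a + INR 6) with (a + 6) by (simpl; ring).
assert (E2 : Gamma (a + INR 2) = (a + 1) * (a * Gamma a)).
{ replace (a + INR 2) with (a + 1 + 1) by (simpl; ring). rewrite !Gamma_succ by lra. ring. }
assert (G4 := Gamma_pos (a + 4) ltac:(lra)).
assert (G6 := Gamma_pos (a + 6) ltac:(lra)).
rewrite E2.
replace (/ ((a + 1) * (a * Gamma a))) with (/ (a * (a + 1)) * / Gamma a) by (field; lra).
replace (Gamma (a + 4) / Gamma a * (1 / 4 + (a + 1) / 3))
  with (Gamma (a + 4) * / Gamma a * (1 / 4 + (a + 1) / 3)) by (unfold Rdiv; ring).
replace (Gamma (a + 6) / (18 * Gamma a)) with (Gamma (a + 6) * / Gamma a * (1 / 18)) by (field; lra).
transitivity (RtoC (/ Gamma a) * (Cexp (- (zeta * zeta / RtoC 4)) *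
  (RtoC (a * (a + 1) ^ 2 * (a + 2) / 2 * / (a * (a + 1))) * J2
   - RtoC (Gamma (a + 4) * / Gamma (a + 4) * (1 / 4 + (a + 1) / 3)) * J4
   + RtoC (Gamma (a + 6) * / Gamma (a + 6) * (1 / 18)) * J6)))%C.
{ rewrite !RtoC_mult. ring. }
replace (a * (a + 1) ^ 2 * (a + 2) / 2 * / (a * (a + 1))) with ((a + 1) * (a + 2) / 2) by (field; lra).
rewrite !Rinv_r, !Rmult_1_l by lra.
rewrite RtoC_opp. ring.
Qed.

(** * Assembly of the expansion *)

Lemma Rpower_half_facts (b : R) : 0 < b ->
  let e := Rpower b (- 1 / 2) in
  0 < e /\ / e ^ 2 = b /\ Rpower b (- 3 / 2) = e ^ 3 /\ / sqrt b = e /\ b * e = / e.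
Proof.
intros Hb e. assert (He : 0 < e) by apply Rpower_pos.
assert (E2 : e ^ 2 = / b).
{ unfold e. rewrite <- Rpower_pow by apply Rpower_pos. rewrite Rpower_mult.
  replace (- 1 / 2 * INR 2) with (- (1)) by (simpl; field).
  rewrite Rpower_Ropp, Rpower_1; auto. }
assert (E4 : / e ^ 2 = b) by (rewrite E2, Rinv_inv; auto).
repeat split; auto.
- unfold e. rewrite <- Rpower_pow by apply Rpower_pos. rewrite Rpower_mult.
  f_equal. simpl; field.
- rewrite <- Rpower_sqrt by auto. unfold e. rewrite <- Rpower_Ropp. f_equal; field.
- rewrite <- E4. field. lra.
Qed.

(* Uniformly for zeta in compact sets (equivalently: in every closed disc
   |zeta| <= r), as b -> +oo:
   1F1(a;b;b(1+b^{-1/2} zeta)) = P(b,zeta) [D_{-a}(-zeta) + A1/b^{1/2} + A2/b + O(b^{-3/2})]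
   with P(b,zeta) = Gamma(b)/Gamma(b-a) b^{-a/2} e^{zeta^2/4}. *)
Theorem theoremB6 (a : R) (ha : 0 < a) (r : R) :
  exists (K B : R), 0 < B /\
    forall (b : R) (zeta : C), B <= b -> Cmod zeta <= r ->
      let P : C := (RtoC (Gamma b / Gamma (b - a) * Rpower b (- a / 2)) *
                    Cexp (zeta * zeta / RtoC 4))%C in
      Cmod (hyp1F1 a b (RtoC b * (RtoC 1 + RtoC (Rpower b (- 1 / 2)) * zeta))%C
            - P * (PCF (- a)%R (- zeta)%C
                   + B6_A1 a zeta / RtoC (sqrt b)
                   + B6_A2 a zeta / RtoC b))%C
      <= K * Rpower b (- 3 / 2) * Cmod P.
Proof.
destruct (laplace_kernel_expansion a ha) as [K1 [HK1 Hexp]].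
destruct (gaussian_moment_domination r) as [C1 [HC1 Hdom]].
(* The error is measured against [Cmod P], which contains the modulus of [e^(zeta^2/4)], at least
   [exp (- (r ^ 2 / 4))]: hence the last factor. [b >= a + 3] yields [c >= 3], [e <= 1] and
   [a + 1 <= / e ^ 2]. *)
exists (K1 * C1 * exp (r ^ 2 / 4)), (a + 3). split; [lra|].
intros b zeta Hb Hz P.
assert (Hr : 0 <= r) by (apply Rle_trans with (2 := Hz); apply Cmod_ge_0).
destruct (Rpower_half_facts b ltac:(lra)) as [He [Eb [E3 [Es Ebe]]]].
assert (Ea : Rpower b (- a / 2) = Rpower (Rpower b (- 1 / 2)) a).
{ rewrite Rpower_mult. f_equal; field. }
unfold P in *. clear P. rewrite Ea, E3. clear Ea E3.
set (e := Rpower b (- 1 / 2)) in *.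
assert (He1 : e <= 1).
{ destruct (Rle_lt_dec e 1); auto. exfalso.
  assert (1 <= e ^ 2) by (apply pow_R1_Rle; lra).
  assert (/ e ^ 2 <= / 1) by (apply Rinv_le_contravar; lra). rewrite Rinv_1 in *. lra. }
set (c := b - a). assert (Hc : 3 <= c) by (unfold c; lra).
set (D := Cexp (- (zeta * zeta / RtoC 4))).
assert (HD : (Cexp (zeta * zeta / RtoC 4) * D = RtoC 1)%C).
{ unfold D. rewrite <- Cexp_plus.
  replace (zeta * zeta / RtoC 4 + - (zeta * zeta / RtoC 4))%C with (RtoC 0) by ring.
  rewrite Cexp_RtoC, exp_0; auto. }
assert (HJ : forall k, exists J, is_laplace (gauss_weight (a + INR k)) zeta J).
{ intros k. apply gauss_weight_laplace_exists. pose proof (pos_INR k); lra. }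
(* One integral for each degree in [s] occurring in the polynomial factor; degree 5 does not occur,
   as both [lap2] and the square of [lap1] are even. *)
destruct (HJ 0%nat) as [J0 H0]. destruct (HJ 1%nat) as [J1 H1].
destruct (HJ 2%nat) as [J2 H2]. destruct (HJ 3%nat) as [J3 H3].
destruct (HJ 4%nat) as [J4 H4]. destruct (HJ 6%nat) as [J6 H6]. clear HJ.
destruct (beta_moment_exists e c a He Hc ha) as [m Hm].
assert (Em := beta_moment_eq e c a m (conj He He1) Hc ha Hm).
set (A := a + 1).
set (Lin := (J0 + RtoC e * (RtoC A * J1 + RtoC (- (1 / 3)) * J3)
  + RtoC (e ^ 2) * (RtoC (A * (a + 2) / 2) * J2 + RtoC (- (1 / 4 + A / 3)) * J4 + RtoC (1 / 18) * J6))%C).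
set (wlin := fun s => gauss_weight a s * (1 + e * lap1 A s + e ^ 2 * (lap2 A s + lap1 A s ^ 2 / 2))).
assert (HLin : is_laplace wlin zeta Lin).
{ refine (is_laplace_ext _ _ _ _ _
   (is_laplace_plus _ _ _ _ _ (is_laplace_plus _ _ _ _ _ H0
     (is_laplace_scal _ e _ _ (is_laplace_plus _ _ _ _ _ (is_laplace_scal _ A _ _ H1)
        (is_laplace_scal _ (- (1 / 3)) _ _ H3))))
     (is_laplace_scal _ (e ^ 2) _ _ (is_laplace_plus _ _ _ _ _ (is_laplace_plus _ _ _ _ _
        (is_laplace_scal _ (A * (a + 2) / 2) _ _ H2)
        (is_laplace_scal _ (- (1 / 4 + A / 3)) _ _ H4))
        (is_laplace_scal _ (1 / 18) _ _ H6))))).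
  intros s Hs. cbv beta. rewrite !gauss_weight_shift by auto.
  unfold wlin, lap1, lap2, A. field. }
set (wbeta := fun s => Rpower s (a - 1) * (exp (s / e) * beta_weight e c s)).
set (wdiff := fun s => wbeta s + (- 1) * wlin s).
assert (Hdiff : forall s, 0 < s -> Rabs (wdiff s) * exp (Cmod zeta * s)
   <= K1 * e ^ 3 * C1 * (Rpower s (a - 1) * exp (- s))).
{ intros s Hs.
  replace (wdiff s) with (Rpower s (a - 1) * (exp (s / e) * beta_weight e c s
      - exp (- (s ^ 2 / 2)) * (1 + e * lap1 A s + e ^ 2 * (lap2 A s + lap1 A s ^ 2 / 2))))
    by (unfold wdiff, wbeta, wlin, gauss_weight; ring).
  pose proof (Rpower_pos s (a - 1)) as Hp.
  rewrite Rabs_mult, (Rabs_pos_eq (Rpower s (a - 1))) by lra.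
  assert (Hk := Hexp e s (conj He He1) ltac:(rewrite Eb; lra) Hs). rewrite Eb in Hk. fold c A in Hk.
  assert (Hd := Hdom s Hs).
  assert (Hz' : exp (Cmod zeta * s) <= exp (r * s)) by (apply exp_le, Rmult_le_compat_r; lra).
  assert (E3 : 0 < e ^ 3) by (apply pow_lt; lra).
  assert (HX : 0 <= (1 + s) ^ 9 * exp (- (s ^ 2 / 2))).
  { apply Rmult_le_pos; [apply pow_le; lra|left; apply exp_pos]. }
  rewrite Rmult_assoc.
  replace (K1 * e ^ 3 * C1 * (Rpower s (a - 1) * exp (- s)))
    with (Rpower s (a - 1) * (K1 * e ^ 3 * (C1 * exp (- s)))) by ring.
  apply Rmult_le_compat_l; [lra|].
  apply Rle_trans with (K1 * e ^ 3 * ((1 + s) ^ 9 * exp (- (s ^ 2 / 2))) * exp (r * s)).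
  - apply Rmult_le_compat; auto; [apply Rabs_pos|left; apply exp_pos].
  - rewrite Rmult_assoc. apply Rmult_le_compat_l; [apply Rmult_le_pos; lra|]. lra. }
(* Convergence for the kernel is deduced from that of the difference and of the truncated expansion,
   so the single estimate [Hdiff] gives both existence and error. *)
assert (HBex : exists L, is_laplace wbeta zeta L).
{ destruct (is_laplace_exists wdiff (K1 * e ^ 3 * C1) a zeta ha) as [L HL]; auto.
  - intros s Hs. unfold wdiff, wbeta, wlin, gauss_weight, lap1, lap2.
    apply (continuous_plus (V := R_NormedModule)).
    + apply (continuous_mult (K := R_AbsRing) (fun s => Rpower s (a - 1)) (fun s => exp (s / e) * beta_weight e c s)).
      * apply continuous_Rpower; auto.
      * apply (continuous_mult (K := R_AbsRing) (fun s => exp (s / e)) (beta_weight e c)).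
        -- apply (ex_derive_continuous (V := R_NormedModule)). auto_derive; auto.
        -- apply continuous_beta_weight; auto.
    + apply (continuous_scal_r (K := R_AbsRing) (V := R_NormedModule) (- 1)).
      apply (continuous_mult (K := R_AbsRing) (fun s => Rpower s (a - 1) * exp (- (s ^ 2 / 2)))).
      * apply (continuous_mult (K := R_AbsRing) (fun s => Rpower s (a - 1)) (fun s => exp (- (s ^ 2 / 2)))).
        -- apply continuous_Rpower; auto.
        -- apply (ex_derive_continuous (V := R_NormedModule)). auto_derive; auto.
      * apply (ex_derive_continuous (V := R_NormedModule)). auto_derive; auto.
  - exists (L + RtoC 1 * Lin)%C.
    refine (is_laplace_ext _ _ _ _ _ (is_laplace_plus _ _ _ _ _ HL (is_laplace_scal _ 1 _ _ HLin))).
    intros s Hs. unfold wdiff. ring. }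
destruct HBex as [L HL].
assert (HLd : Cmod (L + RtoC (- 1) * Lin)%C <= K1 * e ^ 3 * C1 * Gamma a).
{ apply (is_laplace_bound wdiff _ a zeta); auto.
  apply is_laplace_plus; auto. apply is_laplace_scal; auto. }
set (z := (RtoC b * (RtoC 1 + RtoC e * zeta))%C).
assert (Hhyp : hyp1F1 a b z = (RtoC (/ m) * L)%C).
{ replace b with (a + c) at 1 by (unfold c; ring).
  apply (hyp1F1_integral a c e m z L); auto.
  refine (is_pint_ext (V := C_R_NormedModule) _ _ _ _ HL). intros s Hs.
  (* The choice of scale at work: [e * b = / e] for the constant part and [e ^ 2 * b = 1] for the
     part in [zeta]. *)
  replace (RtoC (e * s) * z)%C with (RtoC (s / e) + RtoC s * zeta)%C.
  2:{ replace (s / e) with (s * (b * e)) by (rewrite Ebe; reflexivity).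
    unfold z. replace (RtoC s * zeta)%C with (RtoC (s * (b * e ^ 2)) * zeta)%C.
    - rewrite !RtoC_mult, RtoC_pow. ring.
    - replace (b * e ^ 2) with 1; [rewrite Rmult_1_r; auto|]. rewrite <- Eb; field; lra. }
  rewrite Cexp_plus, Cexp_RtoC, !scal_R_Cmult. unfold wbeta. rewrite !RtoC_mult. as_C_eq; ring. }
assert (Ga := Gamma_pos a ha).
assert (Gc := Gamma_pos c ltac:(lra)).
assert (Gb := Gamma_pos b ltac:(lra)).
set (p := Gamma b / Gamma c * Rpower e a).
assert (Hea := Rpower_pos e a).
assert (Hp : 0 < p).
{ unfold p. apply Rmult_lt_0_compat; auto. apply Rdiv_lt_0_compat; auto. }
(* The normalizing constant is exact, so the whole error comes from the expansion of the kernel. *)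
assert (Hmi : / m = p * / Gamma a).
{ rewrite Em. replace (a + c) with b by (unfold c; ring). rewrite Rpower_Ropp.
  unfold p. field. lra. }
assert (HPCF : PCF (- a) (- zeta) = (RtoC (/ Gamma a) * (D * J0))%C).
{ apply PCF_laplace; auto. simpl in H0. rewrite Rplus_0_r in H0. exact H0. }
rewrite Hhyp, HPCF, (B6_A1_laplace a zeta J1 J3), (B6_A2_laplace a zeta J2 J4 J6) by auto.
fold D A.
unfold Cdiv at 2 3. rewrite <- !RtoC_inv by (try apply Rgt_not_eq, sqrt_lt_R0; lra).
rewrite Es. replace (/ b) with (e ^ 2) by (rewrite <- Eb; symmetry; apply Rinv_inv).
replace (RtoC (/ m) * L - RtoC p * Cexp (zeta * zeta / RtoC 4) *
   (RtoC (/ Gamma a) * (D * J0) +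
    RtoC (/ Gamma a) * (D * (RtoC A * J1 + RtoC (- (1 / 3)) * J3)) * RtoC e +
    RtoC (/ Gamma a) * (D * (RtoC (A * (a + 2) / 2) * J2 + RtoC (- (1 / 4 + A / 3)) * J4 + RtoC (1 / 18) * J6)) * RtoC (e ^ 2)))%C
  with (RtoC (p * / Gamma a) * (L + RtoC (- 1) * Lin))%C.
2:{ rewrite Hmi. transitivity (RtoC (p * / Gamma a) * L - RtoC p * RtoC (/ Gamma a) *
      (Cexp (zeta * zeta / RtoC 4) * D) * Lin)%C.
    - rewrite HD. change (RtoC (- 1)) with (RtoC (- (1))). rewrite RtoC_opp, RtoC_mult. ring.
    - unfold Lin. ring. }
rewrite !Cmod_mult, !Cmod_R, Cmod_Cexp.
rewrite (Rabs_pos_eq p) by lra.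
rewrite (Rabs_pos_eq (p * / Gamma a)).
2:{ apply Rmult_le_pos; [lra|]. left; apply Rinv_0_lt_compat; auto. }
assert (Hre : exp (- (r ^ 2 / 4)) <= exp (fst (zeta * zeta / RtoC 4)%C)).
{ apply exp_le.
  assert (Hm2 : Cmod (- (zeta * zeta / RtoC 4))%C <= r ^ 2 / 4).
  { rewrite Cmod_opp, Cmod_div, Cmod_mult, Cmod_R, Rabs_pos_eq by (try lra; intros Hq; apply RtoC_inj in Hq; lra).
    assert (Cmod zeta * Cmod zeta <= r * r) by (apply Rmult_le_compat; auto; apply Cmod_ge_0).
    simpl; lra. }
  assert (H := fst_le_Cmod (- (zeta * zeta / RtoC 4))%C).
  change (fst (- (zeta * zeta / RtoC 4))%C) with (- fst (zeta * zeta / RtoC 4)%C) in H. lra. }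
assert (E3 : 0 < e ^ 3) by (apply pow_lt; lra).
apply Rle_trans with (p * / Gamma a * (K1 * e ^ 3 * C1 * Gamma a)).
{ apply Rmult_le_compat_l; auto. apply Rmult_le_pos; [lra|]. left; apply Rinv_0_lt_compat; auto. }
replace (p * / Gamma a * (K1 * e ^ 3 * C1 * Gamma a))
  with (K1 * C1 * e ^ 3 * p * (exp (r ^ 2 / 4) * exp (- (r ^ 2 / 4)))).
2:{ rewrite <- exp_plus, Rplus_opp_r, exp_0. field; lra. }
replace (K1 * C1 * exp (r ^ 2 / 4) * e ^ 3 * (p * exp (fst (zeta * zeta / RtoC 4)%C)))
  with (K1 * C1 * e ^ 3 * p * (exp (r ^ 2 / 4) * exp (fst (zeta * zeta / RtoC 4)%C))) by ring.
apply Rmult_le_compat_l.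
- apply Rmult_le_pos; [|lra]. apply Rmult_le_pos; [|lra]. apply Rmult_le_pos; lra.
- apply Rmult_le_compat_l; auto. left; apply exp_pos.
Qed.
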